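(* Let $n\ge 1$ be an integer, $p>1$ and $R>0$. Let $u_0\in C^2(\mathbf{R}^n)$ and $u_1\in C^1(\mathbf{R}^n)$ be real-valued with $\operatorname{supp}u_0,\ \operatorname{supp}u_1\subset\{|x|\le R\}$ and $$\int_{\mathbf{R}^n}u_1(x)\,dx>0.$$ Let $a\in C^1([0,\infty))$ and $b_-\in C([0,\infty))$ satisfy $a(t)>0$ and $b_-(t)>0$ for all $t\ge 0$, put $A(t)=\int_0^t a(s)\,ds$, and assume that $$\alpha:=\sup_{t\ge 0}\frac{n\,a(t)}{A(t)+R}\ \le\ \inf_{t\ge 0}b_-(t)=:\beta.$$ For $\varepsilon>0$, suppose that the Cauchy problem $$\begin{cases} u_{tt}-a(t)^2\Delta u=b_-(t)u_t+|u_t|^p, & t>0,\ x\in\mathbf{R}^n,\\ u(0,x)=\varepsilon u_0(x),\quad u_t(0,x)=\varepsilon u_1(x), & x\in\mathbf{R}^n,\end{cases}$$ has a classical solution $u\in C^2([0,T)\times\mathbf{R}^n)$. Then $T<\infty$, and there exists a constant $\varepsilon_0>0$ such that for $0<\varepsilon\le\varepsilon_0$ the lifespan $T_\varepsilon$ of the solution $u$ satisfies $$T_\varepsilon\le C\varepsilon^{-(p-1)}\ln\frac1\varepsilon\quad\text{if }\beta=\alpha,\qquad\qquad T_\varepsilon\le C\ln\frac1\varepsilon\quad\text{if }\beta>\alpha,$$ where $C>0$ is a constant independent of $\varepsilon$.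
   Context: $\Delta$ is the Laplacian in $x\in\mathbf{R}^n$. The lifespan $T_\varepsilon$ is the supremum of all $T>0$ such that the Cauchy problem (with parameter $\varepsilon$) has a classical solution $u\in C^2([0,T)\times\mathbf{R}^n)$. *)

(* Defs.v *)
From HB Require Import structures.
From mathcomp Require Import all_boot all_order all_algebra.
From mathcomp Require Import all_classical all_reals all_analysis.

Set Implicit Arguments.
Unset Strict Implicit.
Unset Printing Implicit Defensive.

Import Order.TTheory GRing.Theory Num.Theory.
Import numFieldNormedType.Exports.

Local Open Scope classical_set_scope.
Local Open Scope ring_scope.

Section lebesgue_tuple.
Context {R : realType}.
Local Notation T := (measurableTypeR R).

Definition tuple_cons n (z : T * n.-tuple T) : n.+1.-tuple T :=
  [tuple of z.1 :: z.2].

(* n-dimensional Lebesgue measure, as the n-fold product of [lebesgue_measure] *)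
Fixpoint lebesgue_tuple n : set (n.-tuple T) -> \bar R :=
  match n with
  | 0 => @dirac _ (0.-tuple T) [tuple] R
  | m.+1 => pushforward (lebesgue_measure \x @lebesgue_tuple m)%E
                        (@tuple_cons m)
  end.

Lemma measurable_tuple_cons n : measurable_fun setT (@tuple_cons n).
Proof. exact: measurable_cons. Qed.

Lemma measurable_tuple_uncons n :
  measurable_fun setT (fun t : n.+1.-tuple T => (thead t, [tuple of behead t])).
Proof.
apply/measurable_fun_pair; last exact: measurable_behead.
exact: measurable_tnth.
Qed.

Lemma tuple_unconsK n :
  cancel (@tuple_cons n)
         (fun t : n.+1.-tuple T => (thead t, [tuple of behead t])).
Proof. by case=> x t; congr pair; exact/val_inj. Qed.

Section product_step.
Variables (n : nat) (mu : {sigma_finite_measure set (n.-tuple T) -> \bar R}).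

Let nu : {measure set (T * n.-tuple T)%type -> \bar R} :=
  product_measure1 lebesgue_measure mu.

Let m : set (n.+1.-tuple T) -> \bar R := pushforward nu (@tuple_cons n).

Let m0 : m set0 = 0%E.
Proof. by rewrite /m /pushforward preimage_set0 measure0. Qed.

Let m_ge0 A : (0 <= m A)%E. Proof. exact: (measure_ge0 nu). Qed.

Let m_sigma_additive : semi_sigma_additive m.
Proof.
exact: (@measure_semi_sigma_additive _ _ _
  (@measure_function_pushforward__canonical__measure_function_Measure
     _ _ _ _ _ nu _ (@measurable_tuple_cons n))).
Qed.

HB.instance Definition _ := isMeasure.Build _ _ _ m m0 m_ge0 m_sigma_additive.

Let m_sigma_finite : sigma_finite setT m.
Proof.
have /sigma_finiteP[F [UF ndF Foo]] :=
  sigma_finiteT (@lebesgue_measure R : {sigma_finite_measure set T -> \bar R}).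
have /sigma_finiteP[G [UG ndG Goo]] := sigma_finiteT mu.
pose g (t : n.+1.-tuple T) := (thead t, [tuple of behead t]).
exists (fun k => g @^-1` (F k `*` G k)).
  apply/esym/seteqP; split => // t _ /=.
  have [i _ Fi] : (\bigcup_k F k) (g t).1 by rewrite -UF.
  have [j _ Gj] : (\bigcup_k G k) (g t).2 by rewrite -UG.
  exists (maxn i j) => //; split.
    by move: Fi; apply/subsetPset/ndF/leq_maxl.
  by move: Gj; apply/subsetPset/ndG/leq_maxr.
move=> k; have [mF Fk] := Foo k; have [mG Gk] := Goo k; split.
  by rewrite -[X in measurable X]setTI;
    apply: measurable_tuple_uncons => //; exact: measurableX.
rewrite /m /pushforward (_ : _ @^-1` _ = F k `*` G k).
  by rewrite [ltLHS]product_measure1E// lte_mul_pinfty// ge0_fin_numE.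
by apply/seteqP; split => z; rewrite /preimage /mkset /g tuple_unconsK.
Qed.

HB.instance Definition _ := Measure_isSigmaFinite.Build _ _ _ m m_sigma_finite.

Definition product_step : {sigma_finite_measure set (n.+1.-tuple T) -> \bar R} :=
  m.

End product_step.

Section lebesgue_tuple_measure.
Variable n : nat.

Let lebesgue_tupleE : {mu : {sigma_finite_measure set (n.-tuple T) -> \bar R} |
  @lebesgue_tuple n = mu :> (set _ -> \bar R)}.
Proof.
elim: n => [|m [mu muE]]; first by exists (@dirac _ (0.-tuple T) [tuple] R).
by exists (product_step mu); rewrite /= muE.
Qed.

Let lebesgue_tuple0 : @lebesgue_tuple n set0 = 0%E.
Proof. by have [mu ->] := lebesgue_tupleE; exact: measure0. Qed.

Let lebesgue_tuple_ge0 A : (0 <= @lebesgue_tuple n A)%E.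
Proof. by have [mu ->] := lebesgue_tupleE; exact: measure_ge0. Qed.

Let lebesgue_tuple_sigma_additive : semi_sigma_additive (@lebesgue_tuple n).
Proof.
by have [mu ->] := lebesgue_tupleE; exact: measure_semi_sigma_additive.
Qed.

HB.instance Definition _ := isMeasure.Build _ _ _ (@lebesgue_tuple n)
  lebesgue_tuple0 lebesgue_tuple_ge0 lebesgue_tuple_sigma_additive.

Let lebesgue_tuple_sigma_finite : sigma_finite setT (@lebesgue_tuple n).
Proof. by have [mu ->] := lebesgue_tupleE; exact: sigma_finiteT. Qed.

HB.instance Definition _ := Measure_isSigmaFinite.Build _ _ _
  (@lebesgue_tuple n) lebesgue_tuple_sigma_finite.

End lebesgue_tuple_measure.

Lemma lebesgue_tuple_box n (A : 'I_n -> set T) :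
  (forall i, measurable (A i)) ->
  lebesgue_tuple [set t : n.-tuple T | forall i, A i (tnth t i)] =
  (\prod_(i < n) lebesgue_measure (A i))%E.
Proof.
elim: n A => [|n IH] A mA.
  by rewrite big_ord0 /= diracE mem_set//= => -[].
rewrite big_ord_recl -IH; last by move=> i; exact: mA.
set B := [set t : n.-tuple T | _].
have mB : measurable B.
  rewrite (_ : B = \bigcap_i ((fun t => tnth t i) @^-1` A (lift ord0 i))).
    apply: fin_bigcap_measurable => // i _.
    by rewrite -[X in measurable X]setTI; exact: measurable_tnth.
  by apply/seteqP; split => t At i; [move=> _; exact: At | exact: At i I].
rewrite -[RHS]product_measure1E//= /pushforward; congr product_measure1.
apply/seteqP; split => -[x t].
  move=> At; split; first exact: (At ord0).
  by move=> i; have := At (lift ord0 i); rewrite tnthS.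
move=> [Ax At] i; case: (unliftP ord0 i) => [j ->|->//].
by rewrite tnthS; exact: At.
Qed.

End lebesgue_tuple.

Section calculus.
Context {R : realType} {n : nat}.
Implicit Types (f : 'rV[R]_n -> R) (g : R -> R) (u : R -> 'rV[R]_n -> R)
  (T : \bar R).

(* Euclidean norm; the library norm on ['rV[R]_n] is the sup norm. *)
Definition enorm (x : 'rV[R]_n) : R := Num.sqrt (\sum_i x 0 i ^+ 2).

Definition supp f : set 'rV[R]_n := closure [set x | f x != 0].

Definition integral_rV f : R :=
  \int[@lebesgue_tuple R n]_t f (\row_i tnth t i).

Definition partial (i : 'I_n) f (x : 'rV[R]_n) : R := 'D_(delta_mx 0 i) f x.

Definition laplacian f (x : 'rV[R]_n) : R := \sum_i partial i (partial i f) x.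

Fixpoint Ck_rV (k : nat) f : Prop :=
  continuous f /\
  match k with
  | 0 => True
  | j.+1 => forall i, (forall x, derivable f x (delta_mx 0 i)) /\
                      Ck_rV j (partial i f)
  end.

(* Derivative of a function on the half-line [0, +oo[ (values at negative
   arguments are ignored): one-sided at 0, the usual derivative at t > 0. *)
Definition half_quotient g (t h : R) : R := h^-1 * (g (t + h) - g t).

Definition derivable_half g (t : R) : Prop :=
  cvg (half_quotient g t h @[h --> within [set h | 0 <= t + h] 0^']).

Definition derive_half g (t : R) : R :=
  lim (half_quotient g t h @[h --> within [set h | 0 <= t + h] 0^']).

Fixpoint Ck_half (k : nat) g : Prop :=
  {within `[0, +oo[, continuous g} /\
  match k with
  | 0 => True
  | j.+1 => (forall t, 0 <= t -> derivable_half g t) /\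
            Ck_half j (derive_half g)
  end.

(* [0, T[ x R^n, with T possibly +oo *)
Definition strip T : set (R * 'rV[R]_n) := [set z | 0 <= z.1 /\ (z.1%:E < T)%E].

Definition dt u : R -> 'rV[R]_n -> R := fun t x => derive_half (u ^~ x) t.

Definition dx (i : 'I_n) u : R -> 'rV[R]_n -> R := fun t => partial i (u t).

Fixpoint Ck_strip T (k : nat) u : Prop :=
  {within strip T, continuous (fun z => u z.1 z.2)} /\
  match k with
  | 0 => True
  | j.+1 =>
      [/\ forall t x, strip T (t, x) -> derivable_half (u ^~ x) t,
          Ck_strip T j (dt u) &
          forall i,
            (forall t x, strip T (t, x) ->
               derivable (u t) x (delta_mx 0 i)) /\
            Ck_strip T j (dx i u)]
  end.

Definition classical_solution (a b : R -> R) (p : R) (u0 u1 : 'rV[R]_n -> R)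
    (eps : R) T u : Prop :=
  [/\ Ck_strip T 2 u,
      forall t x, 0 < t -> (t%:E < T)%E ->
        dt (dt u) t x - a t ^+ 2 * laplacian (u t) x =
        b t * dt u t x + `|dt u t x| `^ p,
      forall x, u 0 x = eps * u0 x &
      forall x, dt u 0 x = eps * u1 x].

(* The supremum is -oo when there is no classical solution for any T > 0. *)
Definition lifespan (a b : R -> R) (p : R) (u0 u1 : 'rV[R]_n -> R)
    (eps : R) : \bar R :=
  ereal_sup [set T : \bar R |
    (0 < T)%E /\ exists u, classical_solution a b p u0 u1 eps T u].

End calculus.

Definition primitive0 {R : realType} (a : R -> R) (t : R) : R :=
  \int[lebesgue_measure]_(s in `[0, t]) a s.

(* Main.v *)
Require Import Defs.
From mathcomp Require Import all_boot all_order all_algebra.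
From mathcomp Require Import all_classical all_reals all_analysis.
From mathcomp Require Import measurable_realfun.
From mathcomp Require Import ring lra.

Set Implicit Arguments.
Unset Strict Implicit.
Unset Printing Implicit Defensive.

Import Order.TTheory GRing.Theory Num.Theory.
Import numFieldNormedType.Exports.

Local Open Scope classical_set_scope.
Local Open Scope ring_scope.

(* Finite speed of propagation: on the backward light cone of radius B - A(t) about a
   point c, the energy (u_t^2 + a^2 |grad u|^2) / 2 weighted by max(0, D)^2, where
   D = (B - A(t))^2 - |x - c|^2, satisfies E' <= K E. The boundary terms have the good
   sign because the cone shrinks at speed a. Hence u(t, .) has its derivatives
   supported in the cube of half-side A(t) + r, of volume (2 (A(t) + r))^n.
   The mean G of u_t then satisfies G' = b G + \int |u_t|^p, and by Jensen's inequality
   G' >= b G + (2 (A + r))^(-n (p - 1)) G^p. Since n a <= alpha (A + r) integrates to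
   (A + r)^n <= r^n e^(alpha t), the function H = e^(- beta t) G satisfies
   H' >= kappa e^((beta - alpha) (p - 1) t) H^p with H(0) proportional to eps;
   integrating H^(1 - p) bounds the time of existence. *)

(** * Integration of compactly supported continuous functions *)

(** A classical solution carries no decay in x, so even the integrability of u_t in x has to come
    from finite speed; the cone argument is local and asks for no decay. The weight max(0, D)^2 is
    chosen because it is C^1: the localized energy and its flux become compactly supported in x on
    the whole space, and boundary integrals over the cone are replaced by the fact that a divergence
    integrates to zero. Regularity is one-sided at t = 0 and stops at T. Composing with the
    projection onto [0, t1], t1 < T, makes every function continuous for all times, while
    derivatives and the equation are used only for 0 < t < t1. The bound on t1 involves eps but
    neither T nor u, so it yields both T < +oo and the lifespan estimates. The sign of G is unknown
    at first: positivity is obtained with the integrating factor of b itself, and only then is b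
    replaced by its lower bound beta. *)

Section integral_rV.
Context {R : realType}.
Local Notation T := (measurableTypeR R).

Definition row_tuple n (t : n.-tuple T) : 'rV[R]_n := \row_i tnth t i.

(** Cubes rather than Euclidean balls enclose the supports: a cube is a box, so its Lebesgue measure
    is a product of interval lengths. *)
Definition cube n (M : R) : set 'rV[R]_n := [set x | forall i, `|x 0 i| <= M].

Lemma compact_cube n M : compact (@cube n M).
Proof.
rewrite (_ : cube M = [set v : 'rV[R]_n | forall i, `[- M, M]%classic (v ord0 i)]).
  by apply: (@rV_compact _ _ (fun=> `[- M, M]%classic)) => i; exact: segment_compact.
by apply/seteqP; split => x /= h i; have := h i; rewrite in_itv/= ler_norml.
Qed.

Lemma rV_ball n (x y : 'rV[R]_n) (e : R) :
  0 < e -> (forall i, `|x 0 i - y 0 i| < e) -> ball x e y.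
Proof. by move=> e0 h; split => // i j; rewrite (ord1 i); exact: h. Qed.

(* An open set is the countable union of the grid cells of mesh 1/(k+1), k : nat,
   that it contains. *)
Lemma measurable_row_tuple_open n (O : set 'rV[R]_n) :
  open O -> measurable (@row_tuple n @^-1` O).
Proof.
move=> oO.
pose cell (k : nat) (z : {ffun 'I_n -> int}) : set (n.-tuple T) :=
  [set t | forall i, Num.floor (tnth t i * k.+1%:R) = z i].
have mcell k z : measurable (cell k z).
  rewrite (_ : cell k z = \bigcap_i ((fun t => tnth t i) @^-1`
      [set x : R | Num.floor (x * k.+1%:R) = z i])); last first.
    by apply/seteqP; split => t /= h i; [move=> _; exact: h|exact: h].
  apply: fin_bigcap_measurable => // i _.
  rewrite -[X in measurable X]setTI; apply: measurable_tnth => //.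
  rewrite (_ : mkset _ = `[(z i)%:~R / k.+1%:R, (z i + 1)%:~R / k.+1%:R[%classic) //.
  apply/seteqP; split => x /=.
    move=> <-; rewrite in_itv/= ler_pdivrMr// ltr_pdivlMr//.
    by rewrite floor_le floorD1_gt.
  rewrite in_itv/= ler_pdivrMr// ltr_pdivlMr// => h.
  exact: floor_def.
rewrite (_ : _ @^-1` _ = \bigcup_(kz : nat * {ffun 'I_n -> int})
    (if `[< cell kz.1 kz.2 `<=` (@row_tuple n @^-1` O) >] then cell kz.1 kz.2 else set0)).
  apply: countable_bigcupT_measurable; first exact: countableP.
  by move=> [k z]; case: ifP.
apply/seteqP; split => t /=; last first.
  by move=> [[k z] _] /=; case: ifP => // /asboolP; apply.
move=> Ot; have [e /= e0 be] : \forall e \near 0^'+, ball (row_tuple t) e `<=` O.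
  have /nbhs_ballP[d /= d0 bd] := open_nbhs_nbhs (conj oO Ot).
  by exists d => //= x /=; rewrite sub0r normrN => + x0; rewrite gtr0_norm// => xd;
    apply: subset_trans bd => y; exact: le_ball (ltW xd) y.
(* Tuples in a common cell of mesh 1/(k+1) differ by at most 1/(k+1) < e / 2 in each coordinate. *)
pose k := Num.truncn (2 / e).
have ke : k.+1%:R^-1 < e / 2.
  rewrite -[e / 2]invrK ltf_pV2 ?posrE// ?invr_gt0 ?divr_gt0// invf_div.
  by rewrite truncnS_gt.
exists (k, [ffun i => Num.floor (tnth t i * k.+1%:R)]) => //=.
case: ifP => [_ i|]; first by rewrite ffunE.
move/asboolP => []; move=> s /= st.
apply: (be (e / 2)) => //=.
- by rewrite sub0r normrN gtr0_norm ?divr_gt0// ltr_pdivrMr// ltr_pMr// ltr1n.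
- by rewrite divr_gt0.
- apply: rV_ball => [|i]; first by rewrite divr_gt0.
  rewrite !mxE; apply: le_lt_trans ke.
  have := st i; rewrite ffunE => h.
  have k0 : 0 < k.+1%:R :> R by [].
  rewrite -(ler_pM2r k0) mulVf ?gt_eqF// -[X in _ * X]gtr0_norm// -normrM mulrBl.
  have := floor_le (tnth t i * k.+1%:R).
  have := floorD1_gt (tnth t i * k.+1%:R).
  have := floor_le (tnth s i * k.+1%:R).
  have := floorD1_gt (tnth s i * k.+1%:R).
  rewrite h intrD ler_norml => *; lra.
Qed.

Lemma measurable_row_tuple_continuous n (f : 'rV[R]_n -> R) :
  continuous f -> measurable_fun setT (f \o @row_tuple n).
Proof.
move=> cf; apply: (measurability _ (RGenOInfty.measurableE R)) => //.
move=> _ [_ [x ->] <-]; rewrite setTI comp_preimage.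
apply: measurable_row_tuple_open.
by apply: open_comp => [y _|]; [exact: cf|exact: rray_open].
Qed.

Lemma lebesgue_tuple_cube n (M : R) : 0 <= M ->
  lebesgue_tuple (@row_tuple n @^-1` cube M) = ((M *+ 2) ^+ n)%:E.
Proof.
move=> M0; rewrite (_ : _ @^-1` _ =
    [set t : n.-tuple T | forall i, `[- M, M]%classic (tnth t i)]).
  rewrite (lebesgue_tuple_box (A := fun=> `[- M, M]%classic))//.
  rewrite (eq_bigr (fun=> (M *+ 2)%:E)); last first.
    move=> i _; rewrite lebesgue_measure_itv/= lte_fin.
    case: ltrP => h; first by rewrite -EFinB opprK mulr2n.
    by have -> : M = 0; [apply: le_anti; apply/andP; split => //; lra|rewrite mul0rn].
  by rewrite prodEFin prodr_const card_ord.
by apply/seteqP; split => t /= h i; have := h i; rewrite /= !mxE in_itv/= ler_norml.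
Qed.

Lemma measurable_cube n (M : R) : measurable (@row_tuple n @^-1` cube M).
Proof.
rewrite (_ : _ @^-1` _ = \bigcap_i ((fun t : n.-tuple T => tnth t i) @^-1`
      `[- M, M]%classic)).
  apply: fin_bigcap_measurable => // i _.
  by rewrite -[X in measurable X]setTI; exact: measurable_tnth.
apply/seteqP; split => t /= h i; have := h i; rewrite /= !mxE in_itv/= ler_norml; first by [].
exact.
Qed.

Lemma cube_bounded n (f : 'rV[R]_n -> R) M : {within cube M, continuous f} ->
  exists2 C, 0 <= C & forall x, cube M x -> `|f x| <= C.
Proof.
move=> cf; have /compact_bounded[C [_ hC]] := continuous_compact cf (@compact_cube n M).
exists (`|C| + 1); first by rewrite addr_ge0.
move=> x Mx; apply: (hC (`|C| + 1)); last by exists x.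
by rewrite (le_lt_trans (ler_norm _))// ltrDl.
Qed.

Lemma integrable_rV n (f : 'rV[R]_n -> R) M : continuous f ->
  (forall x, ~ cube M x -> f x = 0) ->
  (@lebesgue_tuple R n).-integrable setT (EFin \o (f \o @row_tuple n)).
Proof.
(* The cube of half-side |M| is at least as large, and the volume formula asks for a nonnegative
   half-side. *)
wlog M0 : M / 0 <= M => [hw cf f0|cf f0].
  apply: (hw `|M|) => // x nx; apply: f0 => Mx; apply: nx => i.
  exact: le_trans (Mx i) (ler_norm _).
have [C C0 hC] : exists2 C, 0 <= C & forall x, cube M x -> `|f x| <= C.
  by apply: cube_bounded; exact: continuous_subspaceT.
have -> : f \o @row_tuple n = (f \o @row_tuple n) \_ (@row_tuple n @^-1` cube M).
  apply/funext => t; rewrite patchE; case: ifPn => // /negP.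
  by rewrite inE => h; rewrite /= f0.
rewrite -restrict_EFin; apply/integrable_restrict => //; first exact: measurable_cube.
rewrite setTI; apply: measurable_bounded_integrable.
- exact: measurable_cube.
- by rewrite [ltLHS](lebesgue_tuple_cube n M0) ltry.
- by apply: measurable_funTS; exact: measurable_row_tuple_continuous.
- exists C; split; first exact: num_real.
  by move=> N CN t /= Mt; rewrite (le_trans (hC _ Mt))// ltW.
Qed.
Lemma integral_rVE n (f : 'rV[R]_n -> R) :
  integral_rV f = \int[@lebesgue_tuple R n]_t (f \o @row_tuple n) t.
Proof. by []. Qed.

Lemma integral_rVD n (f g : 'rV[R]_n -> R) M : continuous f -> continuous g ->
  (forall x, ~ cube M x -> f x = 0) -> (forall x, ~ cube M x -> g x = 0) ->
  integral_rV (fun x => f x + g x) = integral_rV f + integral_rV g.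
Proof.
move=> cf cg f0 g0; rewrite /integral_rV RintegralD//.
- exact: (@integrable_rV _ f M).
- exact: (@integrable_rV _ g M).
Qed.

Lemma integral_rVZ n (f : 'rV[R]_n -> R) M k : continuous f ->
  (forall x, ~ cube M x -> f x = 0) ->
  integral_rV (fun x => k * f x) = k * integral_rV f.
Proof.
by move=> cf f0; rewrite /integral_rV RintegralZl//; exact: (@integrable_rV _ f M).
Qed.

Lemma integral_rV0 n : integral_rV (fun _ : 'rV[R]_n => 0) = 0.
Proof. by rewrite /integral_rV Rintegral_cst// mul0r. Qed.

Lemma continuous_sum (V : topologicalType) (I : Type) (s : seq I) (f : I -> V -> R) :
  (forall i, continuous (f i)) -> continuous (fun x => \sum_(i <- s) f i x).
Proof.
move=> cf; elim: s => [|i s IH] x.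
  by rewrite (_ : (fun _ => _) = cst 0); [exact: cst_continuous|apply/funext => y; rewrite big_nil].
rewrite (_ : (fun _ => _) = (fun y => f i y + \sum_(j <- s) f j y)).
  by apply: cvgD; [exact: cf|exact: IH].
by apply/funext => y; rewrite big_cons.
Qed.

Lemma integral_rV_sum n I (s : seq I) (f : I -> 'rV[R]_n -> R) M :
  (forall i, continuous (f i)) -> (forall i x, ~ cube M x -> f i x = 0) ->
  integral_rV (fun x => \sum_(i <- s) f i x) = \sum_(i <- s) integral_rV (f i).
Proof.
move=> cf f0; elim: s => [|i s IH].
  by rewrite big_nil -[RHS](integral_rV0 n); congr integral_rV; apply/funext => x; rewrite big_nil.
rewrite big_cons -IH -(@integral_rVD _ _ _ M)//.
- by congr integral_rV; apply/funext => x; rewrite big_cons.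
- exact: continuous_sum.
- exact: f0.
- by move=> x Mx; rewrite big1 => // j _; exact: f0.
Qed.

Lemma le_integral_rV n (f g : 'rV[R]_n -> R) M : continuous f -> continuous g ->
  (forall x, ~ cube M x -> f x = 0) -> (forall x, ~ cube M x -> g x = 0) ->
  (forall x, f x <= g x) -> integral_rV f <= integral_rV g.
Proof.
move=> cf cg f0 g0 fg; rewrite /integral_rV le_Rintegral//.
- exact: (@integrable_rV _ f M).
- exact: (@integrable_rV _ g M).
Qed.

Lemma integral_rV_ge0 n (f : 'rV[R]_n -> R) : (forall x, 0 <= f x) -> 0 <= integral_rV f.
Proof. by move=> f0; apply: Rintegral_ge0 => t _; exact: f0. Qed.

Lemma integral_rV_cube n (f : 'rV[R]_n -> R) M :
  (forall x, ~ cube M x -> f x = 0) ->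
  integral_rV f = \int[@lebesgue_tuple R n]_(t in @row_tuple n @^-1` cube M) f (row_tuple t).
Proof.
move=> f0; rewrite [RHS]Rintegral_mkcond; congr Rintegral; apply/funext => t.
by rewrite patchE; case: ifPn => // /negP; rewrite inE => h; rewrite f0.
Qed.

(** If f were positive at x0, it would be positive on a box around x0. That box would lie in the
    null set where f may differ from 0, yet it has positive volume. *)
Lemma integral_rV_eq0 n (f : 'rV[R]_n -> R) M : continuous f ->
  (forall x, ~ cube M x -> f x = 0) -> (forall x, 0 <= f x) ->
  integral_rV f = 0 -> forall x, f x = 0.
Proof.
move=> cf f0 fge0 If0 x0; apply/eqP; rewrite eq_le fge0 andbT leNgt; apply/negP => fx0.
have intf := integrable_rV cf f0.
have /(ae_eq_integral_abs _ measurableT (measurable_int _ intf))[N [mN N0 subN]] :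
    (\int[@lebesgue_tuple R n]_x `|(EFin \o (f \o @row_tuple n)) x| = 0)%E.
  under eq_integral do rewrite /= ger0_norm//.
  by rewrite -(fineK (integrable_fin_num measurableT intf)) [fine _]If0.
have /nbhs_ballP[e /= e0 be] : \forall y \near x0, 0 < f y.
  exact: (cvgr_gt (f x0) (cf x0)).
(* Half-side [e / 3] keeps this closed box inside the open ball of radius [e]. *)
pose A i : set T := `[x0 0 i - e / 3, x0 0 i + e / 3]%classic.
have mA i : measurable (A i) by exact: measurable_itv.
have := lebesgue_tuple_box mA.
rewrite (eq_bigr (fun=> (e / 3 *+ 2)%:E)); last first.
  move=> i _; rewrite /A lebesgue_measure_itv/= lte_fin ifT; last by lra.
  by rewrite -EFinB; congr EFin; rewrite mulr2n; lra.
rewrite prodEFin prodr_const card_ord => muA.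
have : (lebesgue_tuple [set t : n.-tuple T | forall i, A i (tnth t i)] <= 0)%E.
  rewrite -N0; apply: le_measure; rewrite ?inE//; first last.
    move=> t At; apply: subN => /= /(_ I) /eqP; apply/negP; rewrite eqe gt_eqF//.
    apply: be; apply: rV_ball => // i; rewrite mxE.
    have := At i; rewrite /A/= in_itv/= ltr_norml => /andP[? ?]; apply/andP; split; lra.
  rewrite (_ : mkset _ = \bigcap_i ((fun t : n.-tuple T => tnth t i) @^-1` A i)).
    apply: fin_bigcap_measurable => // i _.
    by rewrite -[X in measurable X]setTI; exact: measurable_tnth.
  by apply/seteqP; split => t /= h i; [move=> _; exact: h|exact: h].
rewrite muA lee_fin leNgt exprn_gt0// pmulrn_lgt0// divr_gt0//.
Qed.

(** * Fubini's theorem and integrals of partial derivatives *)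

Definition cons_rV n (x : R) (y : 'rV[R]_n) : 'rV[R]_n.+1 :=
  \row_i if unlift ord0 i is Some j then y 0 j else x.

Lemma cons_rV_tuple n (z : T * n.-tuple T) :
  row_tuple (tuple_cons z) = cons_rV z.1 (row_tuple z.2).
Proof.
apply/rowP => i; rewrite !mxE; case: unliftP => [j ->|->]; last by [].
by rewrite mxE tnthS.
Qed.

Lemma continuous_cons_rVl n (y : 'rV[R]_n) : continuous (fun x => cons_rV x y).
Proof.
move=> x; apply/cvg_ballP => e e0; apply: filterS (nbhsx_ballx x e e0) => z xz.
apply: rV_ball => // i; rewrite !mxE.
by case: unliftP => [j _|_]; first by rewrite subrr normr0.
Qed.

Lemma continuous_cons_rVr n x : continuous (fun y : 'rV[R]_n => cons_rV x y).
Proof.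
move=> y A /nbhs_ballP[e /= e0 eA]; apply/nbhs_ballP; exists e => // z [_ yz].
apply: eA; apply: rV_ball => // i; rewrite !mxE.
case: unliftP => [j _|_]; last by rewrite subrr normr0.
exact: yz.
Qed.

Section fubini_rV.
Variables (n : nat) (f : 'rV[R]_n.+1 -> R) (M : R).
Hypotheses (cf : continuous f) (f0 : forall x, ~ cube M x -> f x = 0).
Local Notation mu := (@lebesgue_measure R : {sigma_finite_measure set T -> \bar R}).
Local Notation nu := (@lebesgue_tuple R n : {sigma_finite_measure set _ -> \bar R}).

Let F (z : T * n.-tuple T) : \bar R := (f (cons_rV z.1 (row_tuple z.2)))%:E.

Let FE : F = (EFin \o (f \o @row_tuple n.+1)) \o @tuple_cons R n.
Proof. by apply/funext => z; rewrite /= cons_rV_tuple. Qed.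

Let mf : measurable_fun setT (f \o @row_tuple n.+1).
Proof. exact: measurable_row_tuple_continuous. Qed.

Let pushE (g : n.+1.-tuple T -> \bar R) : 
  (\int[@lebesgue_tuple R n.+1]_t g t =
   \int[pushforward (product_measure1 mu nu) (@tuple_cons R n)]_t g t)%E.
Proof. by apply: eq_measure_integral => A mA _. Qed.

Let intF : (product_measure1 mu nu).-integrable setT F.
Proof.
apply/integrableP; split.
  rewrite FE; apply/measurable_EFinP; apply: measurableT_comp => //; exact: measurable_tuple_cons.
have /integrableP[_] := integrable_rV cf f0.
rewrite pushE ge0_integral_pushforward//; last first.
- by apply/measurable_EFinP; apply: measurableT_comp.
- exact: measurable_tuple_cons.
by rewrite preimage_setT FE.
Qed.

Let integralF : integral_rV f = fine (\int[product_measure1 mu nu]_z F z)%E.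
Proof.
rewrite integral_rVE /Rintegral pushE; congr fine.
rewrite integral_pushforward//.
- by rewrite preimage_setT FE.
- exact: measurable_tuple_cons.
- exact/measurable_EFinP.
- by rewrite preimage_setT -FE.
Qed.

(** Fubini for vanishing slices is all that [integral_rV_partial] calls for; no equation between
    real-valued iterated integrals has to be set up. *)
Lemma integral_rV_head : (forall y, (\int[mu]_x (f (cons_rV x y))%:E = 0)%E) ->
  integral_rV f = 0.
Proof.
move=> h; rewrite integralF -integral21_prod_meas1//.
by rewrite integral0_eq//= => t _; rewrite /fubini_G /F /= h.
Qed.

Lemma integral_rV_tail : (forall x, integral_rV (fun y => f (cons_rV x y)) = 0) ->
  integral_rV f = 0.
Proof.
move=> h; rewrite integralF -integral12_prod_meas1//.
rewrite integral0_eq//= => x _; rewrite /fubini_F /F /=.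
have := h x; rewrite /integral_rV/= /Rintegral => /eqP.
(* A zero [fine] value could come from an infinite integral; integrability of the slice excludes
   this. *)
rewrite fine_eq0; first by move/eqP.
apply: integrable_fin_num => //.
apply: (@integrable_rV n (fun y => f (cons_rV x y)) M).
  by move=> y; apply: continuous_comp; [exact: continuous_cons_rVr|exact: cf].
move=> y ny; apply: f0 => My; apply: ny => i.
by have := My (lift ord0 i); rewrite mxE liftK.
Qed.

End fubini_rV.

Lemma open_cubeC n M : open (~` @cube n M).
Proof.
apply: closed_openC; apply: compact_closed; last exact: compact_cube.
exact: norm_hausdorff.
Qed.

(** The complement of a cube is open, so f vanishes in a neighbourhood of x. *)
Lemma partial_off_cube n (i : 'I_n) (f : 'rV[R]_n -> R) M :
  (forall x, ~ cube M x -> f x = 0) -> forall x, ~ cube M x -> partial i f x = 0.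
Proof.
move=> f0 x Mx; rewrite /partial -(derive_cst (0 : R) x (delta_mx 0 i)).
apply: near_eq_derive; have := open_nbhs_nbhs (conj (open_cubeC (M := M)) Mx).
by apply: filterS => y; exact: f0.
Qed.

Lemma cons_rV_shift0 n (x h : R) (y : 'rV[R]_n) :
  cons_rV (h *: 1 + x) y = h *: delta_mx 0 ord0 + cons_rV x y.
Proof.
apply/rowP => i; rewrite !mxE eqxx/=; case: unliftP => [j ->|->].
  by rewrite eq_sym eq_liftF mulr0 add0r.
by rewrite eqxx.
Qed.

Lemma cons_rV_shift n (x h : R) (y : 'rV[R]_n) (j : 'I_n) :
  cons_rV x (h *: delta_mx 0 j + y) = h *: delta_mx 0 (lift ord0 j) + cons_rV x y.
Proof.
apply/rowP => i; rewrite !mxE eqxx/=; case: unliftP => [k ->|->].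
  by rewrite !mxE/= (inj_eq lift_inj).
by rewrite eq_liftF mulr0 add0r.
Qed.

Lemma integral_derive_itv (g g' : R -> R) (N : R) : 0 < N ->
  (forall x : R, is_derive x 1 g (g' x)) -> continuous g' ->
  (forall x, N <= `|x| -> g x = 0) -> (forall x, N <= `|x| -> g' x = 0) ->
  (\int[@lebesgue_measure R]_x (g' x)%:E = 0)%E.
Proof.
move=> N0 dg cg' g0 g'0.
have cg : continuous g.
  by move=> x; apply: differentiable_continuous; apply/derivable1_diffP; exact: ex_derive.
transitivity (\int[@lebesgue_measure R]_(x in `[(- N)%R, N]) (g' x)%:E)%E.
  rewrite [RHS]integral_mkcond; apply: eq_integral => x _; rewrite patchE.
  case: ifPn => //; rewrite notin_setE/= in_itv/= -ler_norml => /negP; rewrite -ltNge => Nx.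
  by rewrite g'0// ltW.
rewrite (@continuous_FTC2 _ g' g)//.
- by rewrite g0 ?ger0_norm ?(ltW N0)// g0 ?subee// normrN ger0_norm// ltW.
- by rewrite gtrN.
- exact: continuous_subspaceT.
- split=> [x _||]; first exact: ex_derive.
  + by apply: cvg_at_right_filter; exact: cg.
  + by apply: cvg_at_left_filter; exact: cg.
- by move=> x _; rewrite derive1E derive_val.
Qed.

(** Divergence theorem without boundary, by induction on the dimension. If i is the first
    coordinate, the fundamental theorem of calculus kills every line integral; otherwise the first
    coordinate is frozen and the induction hypothesis applies to the slice. *)
Lemma integral_rV_partial n (i : 'I_n) (f : 'rV[R]_n -> R) M :
  (forall x, derivable f x (delta_mx 0 i)) -> continuous (partial i f) ->
  (forall x, ~ cube M x -> f x = 0) -> integral_rV (partial i f) = 0.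
Proof.
elim: n i f => [[]//|n IH] i f df cf f0.
have pf0 := partial_off_cube i f0.
case: (unliftP ord0 i) => [j|] iE.
  apply: (integral_rV_tail cf pf0) => x.
  have gE y : (fun h : R => h^-1 *: (f (h *: delta_mx 0 i + cons_rV x y) - f (cons_rV x y))) =
      (fun h => h^-1 *: (f (cons_rV x (h *: delta_mx 0 j + y)) - f (cons_rV x y))).
    by apply/funext => h; rewrite cons_rV_shift iE.
  have pE y : partial i f (cons_rV x y) = partial j (fun y => f (cons_rV x y)) y.
    by rewrite /partial /derive/= gE.
  under [X in integral_rV X]eq_fun do rewrite pE.
  apply: IH => [y|y|y My].
  - by have := df (cons_rV x y); rewrite /derivable/= gE.
  - rewrite (_ : partial j _ = fun y => partial i f (cons_rV x y)); last by apply/funext.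
    by apply: continuous_comp; [exact: continuous_cons_rVr|exact: cf].
  - apply: f0 => Mxy; apply: My => k.
    by have := Mxy (lift ord0 k); rewrite mxE liftK.
apply: (integral_rV_head cf pf0) => y.
have MN x : `|M| + 1 <= `|x| -> ~ cube M (cons_rV x y).
  move=> Nx Mxy; have := Mxy ord0; rewrite mxE unlift_none => xM.
  have := le_trans Nx (le_trans xM (ler_norm M)); lra.
apply: (@integral_derive_itv (fun x => f (cons_rV x y)) _ (`|M| + 1)).
- by rewrite ltr_pwDr.
- move=> x; have gE :
      (fun h : R => h^-1 *: (f (h *: delta_mx 0 i + cons_rV x y) - f (cons_rV x y))) =
      (fun h => h^-1 *: (f (cons_rV (h *: 1 + x) y) - f (cons_rV x y))).
    by apply/funext => h; rewrite cons_rV_shift0 iE.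
  apply: DeriveDef.
    by have := df (cons_rV x y); rewrite /derivable/= gE.
  by rewrite /partial /derive/= gE.
- by move=> x; apply: continuous_comp; [exact: continuous_cons_rVl|exact: cf].
- by move=> x Nx; exact/f0/MN.
- by move=> x Nx; exact/pf0/MN.
Qed.

(** * Integrals depending on a time parameter *)

Section under_integral.
Variables (n : nat) (f g : R -> 'rV[R]_n -> R) (M : R).
Hypothesis cf : continuous (fun z : R * 'rV[R]_n => f z.1 z.2).
Hypothesis cg : continuous (fun z : R * 'rV[R]_n => g z.1 z.2).
Hypothesis f0 : forall t x, ~ cube M x -> f t x = 0.

Lemma continuous_slice_rV (h : R -> 'rV[R]_n -> R) :
  continuous (fun z : R * 'rV[R]_n => h z.1 z.2) -> forall t, continuous (h t).
Proof.
move=> ch t x; apply: (@continuous_comp _ _ _ (fun x => (t, x)) (fun z => h z.1 z.2)).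
  move=> A [[P Q] [/= nP nQ] PQA]; apply: filterS nQ => y Qy.
  by apply: PQA; split => //=; exact: nbhs_singleton nP.
exact: ch.
Qed.

Lemma continuous_slice_time (h : R -> 'rV[R]_n -> R) :
  continuous (fun z : R * 'rV[R]_n => h z.1 z.2) -> forall x, continuous (h ^~ x).
Proof.
move=> ch x t; apply: (@continuous_comp _ _ _ (fun t => (t, x)) (fun z => h z.1 z.2)).
  move=> A [[P Q] [/= nP nQ] PQA]; apply: filterS nP => s Ps.
  by apply: PQA; split => //=; exact: nbhs_singleton nQ.
exact: ch.
Qed.

Lemma slab_bounded (h : R -> 'rV[R]_n -> R) a b :
  continuous (fun z : R * 'rV[R]_n => h z.1 z.2) ->
  exists2 C, 0 <= C & forall t x, a <= t <= b -> cube M x -> `|h t x| <= C.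
Proof.
move=> ch.
have cK : compact (`[a, b]%classic `*` @cube n M).
  by apply: compact_setX; [exact: segment_compact|exact: compact_cube].
have /compact_bounded[C [_ hC]] :=
  continuous_compact (continuous_subspaceT ch : {within _, continuous _}) cK.
exists (`|C| + 1); first by rewrite addr_ge0.
move=> t x tab Mx; apply: (hC (`|C| + 1)).
  by rewrite (le_lt_trans (ler_norm _))// ltrDl.
by exists (t, x) => //; split => //=; rewrite in_itv.
Qed.

Let B := @row_tuple n @^-1` cube M.

Let mB : measurable B. Proof. exact: measurable_cube. Qed.

Let intB (h : 'rV[R]_n -> R) : continuous h -> (forall x, ~ cube M x -> h x = 0) ->
  (@lebesgue_tuple R n).-integrable B (EFin \o (h \o @row_tuple n)).
Proof. by move=> ch h0; apply: integrableS (integrable_rV ch h0). Qed.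

Let int_cst (C : R) : (@lebesgue_tuple R n).-integrable B (EFin \o cst C).
Proof.
apply: measurable_bounded_integrable => //; last exact: bounded_cst.
(* [M] may be negative here, so finiteness is read off from the cube of half-side |M|. *)
apply: (@le_lt_trans _ _ (lebesgue_tuple (@row_tuple n @^-1` cube `|M|))).
  apply: le_measure; rewrite ?inE//; first exact: measurable_cube.
  by move=> t /= Mt i; rewrite (le_trans (Mt i))// ler_norm.
by rewrite [ltLHS]lebesgue_tuple_cube// ltry.
Qed.

Lemma continuous_integral_rV : continuous (fun t => integral_rV (f t)).
Proof.
move=> t; have [C C0 hC] := slab_bounded (t - 1) (t + 1) cf.
under [X in continuous_at _ X]eq_fun do rewrite (integral_rV_cube (f0 _)).
apply: (@continuity_under_integral _ _ _ _ (fun t y => f t (row_tuple y)) B mB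
  (t - 1) (t + 1) _ _ (cst C)) => //.
- by move=> x _; apply: intB; [exact: continuous_slice_rV|exact: f0].
- by apply/aeW => y _ s _; exact: continuous_slice_time.
- move=> s; rewrite /= in_itv/= => /andP[s1 s2]; apply/aeW => y My; apply: hC => //.
  by rewrite !ltW.
- by rewrite inE/= in_itv/=; apply/andP; split; lra.
Qed.

(** A constant on the cube serves as majorant, by compactness of the slab. Derivatives are asked for
    only on ]u, v[ because clamped functions may have kinks at the ends. *)
Lemma is_derive_integral_rV u v (t : R) :
  (forall (s : R) x, u < s < v -> is_derive s 1 (f ^~ x) (g s x)) ->
  (forall x, ~ cube M x -> g t x = 0) ->
  u < t < v -> is_derive t 1 (fun t => integral_rV (f t)) (integral_rV (g t)).
Proof.
move=> dfg g0 tuv; have [C C0 hC] := slab_bounded u v cg.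
have It : (`]u, v[%classic : set R) t by rewrite /= in_itv.
have d1 s x : u < s < v -> derive1 (f ^~ x) s = g s x.
  by move=> suv; rewrite derive1E; have := dfg s x suv; move=> [].
have intf s : (`]u, v[%classic : set R) s ->
    (@lebesgue_tuple R n).-integrable B (EFin \o (fun y => f s (row_tuple y))).
  by move=> _; apply: (intB (h := f s)); [exact: continuous_slice_rV|exact: f0].
have df s y : (`]u, v[%classic : set R) s -> B y -> derivable (fun s => f s (row_tuple y)) s 1.
  by rewrite /= in_itv/= => suv _; have := dfg s (row_tuple y) suv; move=> [].
have G_ub s y : (`]u, v[%classic : set R) s -> B y ->
    `|partial1of2 (fun s y => f s (row_tuple y)) s y| <= cst C y.
  rewrite /= in_itv/= => suv My; rewrite /partial1of2 d1//; apply: hC => //.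
  by case/andP : suv => ? ?; rewrite !ltW.
have D1 := derivable_under_integral mB It intf df (fun=> C0) (int_cst C) G_ub.
have D2 := differentiation_under_integral mB It intf df (fun=> C0) (int_cst C) G_ub.
under [X in is_derive _ _ X]eq_fun do rewrite (integral_rV_cube (f0 _)).
apply: DeriveDef; first exact: D1.
rewrite -derive1E D2 (integral_rV_cube g0).
by apply: eq_Rintegral => y _; rewrite /partial1of2 d1.
Qed.

End under_integral.

(** * Jensen's inequality on a cube *)

Lemma continuous_norm_powR (p : R) : 0 < p -> continuous (fun x : R => `|x| `^ p).
Proof.
move=> p0 x; have [->|x0] := eqVneq x 0.
  apply/cvgrPdist_lt => e e0; rewrite normr0 powR0 ?gt_eqF//; near=> y.
  rewrite sub0r normrN ger0_norm ?powR_ge0//.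
  (* Writing e as (e^(1/p))^p reduces the goal to |y| < e^(1/p). *)
  rewrite -[e]powRr1 ?ltW// -(mulVf (lt0r_neq0 p0)) powRrM gt0_ltr_powR// ?nnegrE//.
  - exact: powR_ge0.
  - near: y; apply: (@nbhs0_lt R R^o); exact: powR_gt0.
apply: (@continuous_comp _ _ _ (fun x : R => `|x|) (fun y => y `^ p)).
  exact: norm_continuous.
apply: differentiable_continuous; apply/derivable1_diffP; apply: derivable_powR.
by rewrite in_itv/= normr_gt0 x0.
Unshelve. all: end_near. Qed.

(** The tangent line to y^p at the mean value l = J / V lies below |y|^p. Integrated over the cube
    it gives p l^(p-1) J - (p-1) l^p V = l^p V, which is the left-hand side. *)
Lemma Jensen_rV n (f : 'rV[R]_n -> R) M p : 0 < M -> 1 < p -> continuous f ->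
  (forall x, ~ cube M x -> f x = 0) -> 0 < integral_rV f ->
  ((M *+ 2) ^+ n) `^ (1 - p) * integral_rV f `^ p <= integral_rV (fun x => `|f x| `^ p).
Proof.
move=> M0 p1 cf f0 If0; set V := (M *+ 2) ^+ n; set J := integral_rV f.
have V0 : 0 < V by rewrite exprn_gt0// pmulrn_lgt0.
have p0 : 0 < p by exact: lt_trans p1.
pose l := J / V; have l0 : 0 < l by rewrite divr_gt0.
have cfp : continuous (fun x => `|f x| `^ p).
  by move=> x; apply: (@continuous_comp _ _ _ f (fun y => `|y| `^ p));
    [exact: cf|exact: continuous_norm_powR].
have fp0 x : ~ cube M x -> `|f x| `^ p = 0.
  by move=> Mx; rewrite f0// normr0 powR0 ?gt_eqF.
have -> : V `^ (1 - p) * J `^ p = p * l `^ (p - 1) * J - (p - 1) * l `^ p * V.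
  have -> : J = l * V by rewrite /l divfK ?gt_eqF.
  rewrite -(mulr_powRB1 (ltW l0) p0) powRM ?ltW// -(mulr_powRB1 (ltW l0) p0).
  rewrite (@powRB _ V 1 p) ?(gt_eqF V0) ?implybT// powRr1 ?ltW//.
  have : V `^ p != 0 by rewrite gt_eqF// powR_gt0.
  by move=> ?; field.
(* Young's inequality for |f x| and l^(p-1), with conjugate exponents p and p / (p - 1). *)
have young x : p * l `^ (p - 1) * f x - (p - 1) * l `^ p <= `|f x| `^ p.
  have := @conjugate_powR _ `|f x| (l `^ (p - 1)) p (p / (p - 1)) (normr_ge0 _) (powR_ge0 _ _) p0.
  rewrite divr_gt0 ?subr_gt0// => /(_ isT) h.
  have pB1 : p - 1 != 0 by rewrite subr_eq0 gt_eqF.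
  have pq : (p - 1) * (p / (p - 1)) = p by field.
  rewrite -powRrM pq invf_div mulrC in h.
  have {}h : l `^ (p - 1) * `|f x| <= `|f x| `^ p / p + l `^ p * ((p - 1) / p).
    by rewrite mulrC [(p - 1) / p]mulrC; apply: h; field; rewrite gt_eqF.
  have {}h : p * (l `^ (p - 1) * `|f x|) <= `|f x| `^ p + (p - 1) * l `^ p.
    rewrite -(ler_pM2l p0) in h; apply: (le_trans h); rewrite le_eqVlt; apply/orP; left.
    by apply/eqP; field; rewrite gt_eqF.
  have := ler_wpM2l (powR_ge0 l (p - 1)) (ler_norm (f x)) => h2.
  have := ler_wpM2l (ltW p0) h2; lra.
have intB (h : 'rV[R]_n -> R) : continuous h -> (forall x, ~ cube M x -> h x = 0) ->
    (@lebesgue_tuple R n).-integrable (@row_tuple n @^-1` cube M) (EFin \o (h \o @row_tuple n)).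
  by move=> ch h0; apply: integrableS (integrable_rV ch h0) => //; exact: measurable_cube.
have intC (C : R) : (@lebesgue_tuple R n).-integrable (@row_tuple n @^-1` cube M) (EFin \o cst C).
  apply: measurable_bounded_integrable => //; [exact: measurable_cube| |exact: bounded_cst].
  by rewrite [ltLHS]lebesgue_tuple_cube ?ltW// ltry.
rewrite [leRHS](integral_rV_cube fp0).
have -> : p * l `^ (p - 1) * J - (p - 1) * l `^ p * V =
    \int[@lebesgue_tuple R n]_(t in @row_tuple n @^-1` cube M)
      (p * l `^ (p - 1) * f (row_tuple t) - (p - 1) * l `^ p).
  rewrite RintegralB//; last 3 first.
  - exact: measurable_cube.
  - apply: (intB (fun x => p * l `^ (p - 1) * f x)) => [x|x Mx]; last by rewrite f0// mulr0.
    exact: cvgM (cvg_cst _) (cf x).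
  - exact: intC.
  rewrite RintegralZl; [|exact: measurable_cube|exact: (intB f)].
  rewrite -integral_rV_cube// Rintegral_cst; last exact: measurable_cube.
  by rewrite [X in fine X]lebesgue_tuple_cube ?ltW.
apply: le_Rintegral; first exact: measurable_cube.
- rewrite /comp; under eq_fun do rewrite EFinB.
  apply: integrableB => //; [exact: measurable_cube| |exact: intC].
  apply: (intB (fun x => p * l `^ (p - 1) * f x)) => [x|x Mx]; last by rewrite f0// mulr0.
  exact: cvgM (cvg_cst _) (cf x).
- exact: (intB (fun x => `|f x| `^ p)).
- by move=> t _; exact: young.
Qed.

End integral_rV.

(** * Differential calculus *)

Section derivation.
Context {R : realType}.

(** Both difference quotients are the same function of h. Directional derivatives thus inherit the
    one-variable chain rule, with no Frechet differentiability of f. *)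
Lemma is_derive_line (V : normedModType R) (f : V -> R) (x v : V) (l : R) :
  is_derive x v f l <-> is_derive (0 : R) 1 (fun h : R => f (h *: v + x)) l.
Proof.
have E : (fun h : R => h^-1 *: (f (h *: v + x) - f x)) =
    (fun h : R => h^-1 *: (f ((h *: (1 : R) + 0 : R) *: v + x) - f ((0 : R) *: v + x))).
  by apply/funext => h; rewrite addr0 scale0r add0r [h%:A]mulr1.
by split=> -[d1 d2]; apply: DeriveDef; move: d1 d2; rewrite /derivable /derive /= E.
Qed.

Lemma is_derive_line_at (V : normedModType R) (f : V -> R) (x v : V) (s l : R) :
  is_derive (s *: v + x) v f l <-> is_derive s 1 (fun h : R => f (h *: v + x)) l.
Proof.
have E : (fun h : R => h^-1 *: (f (h *: v + (s *: v + x)) - f (s *: v + x))) =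
    (fun h : R => h^-1 *: (f ((h *: (1 : R) + s : R) *: v + x) - f (s *: v + x))).
  by apply/funext => h; rewrite scalerDl addrA [h%:A]mulr1.
by split=> -[d1 d2]; apply: DeriveDef; move: d1 d2; rewrite /derivable /derive /= E.
Qed.

Section algebra.
Variable V : normedModType R.
Implicit Types (f g : V -> R) (x v : V) (df dg k : R).

(** The rules are restated for explicit functions of y, so that derivative proofs compose as
    terms. *)
Lemma is_derive_mul f g x v df dg : is_derive x v f df -> is_derive x v g dg ->
  is_derive x v (fun y => f y * g y) (f x * dg + g x * df).
Proof. by move=> hf hg; exact: is_deriveM. Qed.

Lemma is_derive_add f g x v df dg : is_derive x v f df -> is_derive x v g dg ->
  is_derive x v (fun y => f y + g y) (df + dg).
Proof. by move=> hf hg; exact: is_deriveD. Qed.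

Lemma is_derive_sub f g x v df dg : is_derive x v f df -> is_derive x v g dg ->
  is_derive x v (fun y => f y - g y) (df - dg).
Proof. by move=> hf hg; exact: is_deriveB. Qed.

Lemma is_derive_const k x v : is_derive x v (fun _ => k) 0.
Proof. exact: is_derive_cst. Qed.

Lemma is_derive_sqr f x v df : is_derive x v f df ->
  is_derive x v (fun y => f y ^+ 2) (2 * f x * df).
Proof.
move=> hf; have -> : 2 * f x * df = f x * df + f x * df by ring.
rewrite (_ : (fun _ => _) = (fun y => f y * f y)); first exact: is_derive_mul.
by apply/funext => y; rewrite expr2.
Qed.

Lemma is_derive_pow f x v df (m : nat) : is_derive x v f df ->
  is_derive x v (fun y => f y ^+ m.+1) (m.+1%:R * f x ^+ m * df).
Proof.
move=> hf; elim: m => [|m IH].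
  by under eq_fun do rewrite expr1; rewrite expr0 mulr1 mul1r.
rewrite (_ : (fun _ => _) = (fun y => f y * f y ^+ m.+1)).
  apply: (is_derive_eq (is_derive_mul hf IH)).
  by rewrite -[m.+2%:R]natr1 [f x ^+ m.+1]exprS; ring.
by apply/funext => y; rewrite exprS.
Qed.

Lemma is_derive_bigsum n (f : 'I_n -> V -> R) x v (df : 'I_n -> R) :
  (forall i, is_derive x v (f i) (df i)) ->
  is_derive x v (fun y => \sum_i f i y) (\sum_i df i).
Proof.
move=> h; rewrite (_ : (fun _ => _) = \sum_i f i); first exact: is_derive_sum.
by apply/funext => y; rewrite fct_sumE.
Qed.

Lemma is_derive_chain f (q : R -> R) x v df dq :
  is_derive x v f df -> is_derive (f x) 1 q dq ->
  is_derive x v (fun y => q (f y)) (dq * df).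
Proof.
move=> /is_derive_line hf hq; apply/is_derive_line.
apply: (@is_derive1_comp _ q (fun h : R => f (h *: v + x))).
by rewrite scale0r add0r.
Qed.

End algebra.

Lemma is_derive_continuous (f : R -> R) (x df : R) : is_derive x 1 f df -> {for x, continuous f}.
Proof. by move=> h; apply: differentiable_continuous; apply/derivable1_diffP; exact: ex_derive. Qed.

Lemma is_derive_expRM (k s : R) :
  is_derive s 1 (fun t : R => expR (k * t)) (expR (k * s) * k).
Proof.
apply: (@is_derive_chain _ (fun t => k * t) expR).
have := @is_derive_mul R^o (fun=> k) id s 1 0 1 (is_derive_cst _ _ _) (is_derive_id _ _).
by rewrite mulr1 mulr0 addr0.
Qed.

Lemma continuous_expRM (k : R) : continuous (fun t : R => expR (k * t)).
Proof. by move=> t; exact: is_derive_continuous (is_derive_expRM k t). Qed.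

Lemma is_derive_coord n (i j : 'I_n) (x : 'rV[R]_n) :
  is_derive x (delta_mx 0 i) (fun y : 'rV[R]_n => y 0 j) (i == j)%:R.
Proof.
apply/is_derive_line.
rewrite (_ : (fun _ => _) = (fun h : R => h * (i == j)%:R + x 0 j)).
  by apply: is_derive_eq; rewrite addr0 scaler0 add0r /GRing.scale/= mulr1.
by apply/funext => h; rewrite !mxE eqxx/= eq_sym.
Qed.

(** This is max(0, s), in a form whose continuity is immediate. *)
Definition pos_part (s : R) : R := (s + `|s|) / 2.

Lemma pos_part_ge0 s : 0 <= pos_part s.
Proof. by rewrite divr_ge0//; have := ler_norm (- s); rewrite normrN; lra. Qed.

Lemma ge0_pos_part s : 0 <= s -> pos_part s = s.
Proof. by move=> s0; rewrite /pos_part ger0_norm//; field. Qed.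

Lemma le0_pos_part s : s <= 0 -> pos_part s = 0.
Proof. by move=> s0; rewrite /pos_part ler0_norm// subrr mul0r. Qed.

Lemma continuous_pos_part : continuous pos_part.
Proof.
move=> x; apply: cvgM; last exact: cvg_cst.
by apply: cvgD; [exact: cvg_id|exact: norm_continuous].
Qed.

(** The only delicate point is 0, where [pos_part] itself is a Caratheodory slope function, since
    pos_part(z)^2 = pos_part(z) z. *)
Lemma is_derive_pos_part_sqr (x : R) :
  is_derive x 1 (fun s : R => pos_part s ^+ 2) (2 * pos_part x).
Proof.
have [x0|x0|<-] := ltgtP 0 x.
- apply: (@near_eq_is_derive _ _ _ (fun s : R => s ^+ 2)).
    near=> s; rewrite ge0_pos_part//; apply: ltW; near: s; exact: lt_nbhsr.
  have := @is_derive_sqr R^o id x 1 1 (is_derive_id _ _).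
  by rewrite mulr1 ge0_pos_part// ltW.
- apply: (@near_eq_is_derive _ _ _ (fun s : R => 0)).
    near=> s; rewrite le0_pos_part ?expr0n//; apply: ltW; near: s; exact: lt_nbhsl.
  by rewrite le0_pos_part ?mulr0 ?ltW//; exact: is_derive_cst.
- rewrite le0_pos_part// mulr0; apply/is_derive1_caratheodory; exists pos_part; split.
  + move=> z; rewrite [pos_part 0]le0_pos_part// expr0n !subr0 expr2.
    have [z0|/ltW z0] := leP 0 z; first by rewrite ge0_pos_part.
    by rewrite le0_pos_part// !mul0r.
  + exact: continuous_pos_part.
  + exact: le0_pos_part.
Unshelve. all: end_near. Qed.

(** The second difference of f over a small square is evaluated by two mean value steps, in either
    order. Continuity of both mixed derivatives at the corner then forces them to agree up to any
    e. *)
Lemma Schwarz_mixed (f ft fs fts fst : R -> R -> R) (a b t0 s0 : R) :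
  a < t0 < b ->
  (forall t s : R, a < t < b -> is_derive t 1 (f ^~ s) (ft t s)) ->
  (forall t s : R, a < t < b -> is_derive s 1 (f t) (fs t s)) ->
  (forall t s : R, a < t < b -> is_derive s 1 (ft t) (fts t s)) ->
  (forall t s : R, a < t < b -> is_derive t 1 (fs ^~ s) (fst t s)) ->
  {for (t0, s0), continuous (fun z : R * R => fts z.1 z.2)} ->
  {for (t0, s0), continuous (fun z : R * R => fst z.1 z.2)} ->
  fts t0 s0 = fst t0 s0.
Proof.
move=> /andP[at0 t0b] dft dfs dfts dfst cts cst.
apply/eqP; rewrite -subr_eq0 -normr_le0; apply/ler_addgt0Pr => e e0; rewrite add0r.
have e20 : 0 < e / 2 by rewrite divr_gt0.
have /nbhs_ballP[d1 /= d10 b1] : \forall z \near (t0, s0), `|fts t0 s0 - fts z.1 z.2| < e / 2.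
  exact: ((cvgrPdist_lt _ _).1 cts _ e20).
have /nbhs_ballP[d2 /= d20 b2] : \forall z \near (t0, s0), `|fst t0 s0 - fst z.1 z.2| < e / 2.
  exact: ((cvgrPdist_lt _ _).1 cst _ e20).
(* Half of the minimum keeps the square inside both continuity balls and its time side below [b]. *)
pose h := Num.min (Num.min d1 d2) (b - t0) / 2.
have h0 : 0 < h by rewrite divr_gt0// !lt_min d10 d20 subr_gt0.
have [hd1 hd2 hb] : [/\ h < d1, h < d2 & t0 + h < b].
  have : Num.min (Num.min d1 d2) (b - t0) <= d1 by rewrite !ge_min lexx.
  have : Num.min (Num.min d1 d2) (b - t0) <= d2 by rewrite !ge_min lexx orbT.
  have : Num.min (Num.min d1 d2) (b - t0) <= b - t0 by rewrite !ge_min lexx orbT.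
  by rewrite /h in h0 *; split; lra.
have tab t : t \in `[t0, t0 + h] -> a < t < b.
  by rewrite in_itv/= => /andP[? ?]; apply/andP; split; lra.
have mvt (k dk : R -> R) u : (forall t, u <= t <= u + h -> is_derive t 1 k (dk t)) ->
    exists2 c, u < c < u + h & k (u + h) - k u = dk c * h.
  move=> dk'; have [|||c] := @MVT _ k dk u (u + h).
  - by rewrite ltrDl.
  - by move=> t; rewrite in_itv/= => /andP[? ?]; apply: dk'; rewrite !ltW.
  - apply: derivable_within_continuous => t; rewrite in_itv/= => tuh.
    by have := dk' t tuh; move=> [].
  by rewrite in_itv/= addrAC subrr add0r => ? ?; exists c.
have [c1 c1h E1] := mvt (fun t => f t (s0 + h) - f t s0) (fun t => ft t (s0 + h) - ft t s0) t0
  (fun t ht => is_derive_sub (dft t (s0 + h) (tab t ht)) (dft t s0 (tab t ht))).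
have c1ab : a < c1 < b by apply: tab; rewrite in_itv/=; case/andP : c1h => ? ?; rewrite !ltW.
have [c2 c2h E2] := mvt (ft c1) (fts c1) s0 (fun s _ => dfts c1 s c1ab).
have hab : a < t0 + h < b by apply: tab; rewrite in_itv/= lexx lerDl ltW.
have t0ab : a < t0 < b by rewrite at0.
have [c3 c3h E3] := mvt (fun s => f (t0 + h) s - f t0 s) (fun s => fs (t0 + h) s - fs t0 s) s0
  (fun s _ => is_derive_sub (dfs _ s hab) (dfs _ s t0ab)).
have [c4 c4h E4] := mvt (fs ^~ c3) (fst ^~ c3) t0 (fun t ht => dfst t c3 (tab t ht)).
(* Both products with h^2 are the same second difference. *)
have E : fts c1 c2 = fst c4 c3.
  have : fts c1 c2 * h * h = fst c4 c3 * h * h by rewrite -E2 -E4 -E1 -E3; ring.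
  by move/(mulIf (lt0r_neq0 h0))/(mulIf (lt0r_neq0 h0)).
have bR (x y d : R) : `|x - y| < d -> ball x d y by rewrite -ball_normE.
move: c1h c2h c3h c4h => /andP[? ?] /andP[? ?] /andP[? ?] /andP[? ?].
have B1 : `|fts t0 s0 - fts c1 c2| < e / 2.
  apply: (b1 (c1, c2)); split; apply: bR; rewrite /= ltr_norml; lra.
have B2 : `|fst t0 s0 - fst c4 c3| < e / 2.
  apply: (b2 (c4, c3)); split; apply: bR; rewrite /= ltr_norml; lra.
move: B1 B2; rewrite E !ltr_norml ler_norml => /andP[? ?] /andP[? ?].
apply/andP; split; lra.
Qed.

(** For t > 0 the constraint 0 <= t + h holds for all small h, so the restricted filter is the
    punctured neighbourhood filter. *)
Lemma derivable_half_is_derive (g : R -> R) (t : R) : 0 < t -> derivable_half g t ->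
  is_derive t 1 g (derive_half g t).
Proof.
move=> t0 dg.
have E : within [set h | 0 <= t + h] 0^' = (0 : R)^'.
  apply/seteqP; split => P /=; last by apply: cvg_within.
  rewrite /within/= => h; near=> s.
  apply: (near h) => //=; rewrite -lerBlDl sub0r; apply: ltW.
  by near: s; apply: filterS (dnbhs0_lt t0) => s; rewrite ltr_norml => /andP[].
have qE : half_quotient g t = (fun h : R => h^-1 *: (g (h *: 1 + t) - g t)).
  by apply/funext => h; rewrite /half_quotient [h%:A]mulr1 [t + h]addrC.
move: dg; rewrite /derivable_half /derive_half E qE => dg.
exact: DeriveDef.
Unshelve. all: end_near. Qed.

End derivation.

Section continuity.
Context {R : realType} {X : topologicalType}.
Implicit Types f g : X -> R.

Lemma continuous_mul f g : continuous f -> continuous g -> continuous (fun x => f x * g x).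
Proof. by move=> cf cg x; exact: cvgM (cf x) (cg x). Qed.

Lemma continuous_add f g : continuous f -> continuous g -> continuous (fun x => f x + g x).
Proof. by move=> cf cg x; exact: cvgD (cf x) (cg x). Qed.

Lemma continuous_sub f g : continuous f -> continuous g -> continuous (fun x => f x - g x).
Proof. by move=> cf cg x; exact: cvgB (cf x) (cg x). Qed.

Lemma continuous_const (k : R) : continuous (fun _ : X => k).
Proof. exact: cst_continuous. Qed.

Lemma continuous_pow f k : continuous f -> continuous (fun x => f x ^+ k).
Proof.
move=> cf; elim: k => [|k IH]; first exact: continuous_const.
by under eq_fun do rewrite exprS; exact: continuous_mul.
Qed.

Lemma continuous_compose (Y Z : topologicalType) (f : X -> Y) (g : Y -> Z) :
  continuous f -> continuous g -> continuous (fun x => g (f x)).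
Proof. by move=> cf cg x; apply: (@continuous_comp _ _ _ f g); [exact: cf|exact: cg]. Qed.

Lemma continuous_within_comp (Y Z : topologicalType) (f : X -> Y) (g : Y -> Z) (A : set Y) :
  continuous f -> (forall x, A (f x)) -> {within A, continuous g} ->
  continuous (fun x => g (f x)).
Proof.
move=> cf Af /subspace_continuousP cg x U /(cg _ (Af x)) gU.
have fU : nbhs (f x) [set y | A y -> U (g y)] by exact: gU.
change (nbhs x [set y | U (g (f y))]).
have fU' : nbhs x [set y | A (f y) -> U (g (f y))] := cf x _ fU.
by apply: filterS fU' => y /=; apply; exact: Af.
Qed.

End continuity.

(** * Extension from [0, t1] to the whole line *)

Section clamp.
Context {R : realType}.
Variable t1 : R.
Hypothesis t1_gt0 : 0 < t1.

(* The projection of the real line onto [0, t1]: composing with it makes functions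
   that are continuous on [0, t1] continuous everywhere. *)
Definition clamp (t : R) : R := (`|t| + t1 - `|t - t1|) / 2.

Lemma clamp_itv t : 0 <= clamp t <= t1.
Proof.
by have := t1_gt0; rewrite /clamp; case: (ger0P t) => ?; case: (ger0P (t - t1)) => ? ?; lra.
Qed.

Lemma clampE t : 0 <= t <= t1 -> clamp t = t.
Proof.
by move=> /andP[t0 tt1]; rewrite /clamp ger0_norm// ler0_norm ?subr_le0//; field.
Qed.

Lemma clamp_homo s t : s <= t -> clamp s <= clamp t.
Proof.
rewrite /clamp => st.
by have := t1_gt0; case: (ger0P t) => ?; case: (ger0P (t - t1)) => ?;
  case: (ger0P s) => ?; case: (ger0P (s - t1)) => ? ?; lra.
Qed.

Lemma continuous_clamp : continuous clamp.
Proof.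
apply: continuous_mul; last exact: continuous_const.
apply: continuous_sub; last first.
  apply: (continuous_compose (f := fun t => t - t1)) => [|x]; last exact: norm_continuous.
  by apply: continuous_sub => [x|]; [exact: cvg_id|exact: continuous_const].
by apply: continuous_add => [x|]; [exact: norm_continuous|exact: continuous_const].
Qed.

Lemma is_derive_clamp (g : R -> R) t l : 0 < t < t1 -> is_derive t 1 g l ->
  is_derive t 1 (fun s => g (clamp s)) l.
Proof.
move=> /andP[t0 tt1]; apply: near_eq_is_derive; near=> s; rewrite clampE//.
by apply/andP; split; apply: ltW; near: s; [exact: lt_nbhsr|exact: lt_nbhsl].
Unshelve. all: end_near. Qed.

Lemma continuous_clamp_strip n (T : \bar R) (h : R -> 'rV[R]_n -> R) : (t1%:E < T)%E ->
  {within strip T, continuous (fun z => h z.1 z.2)} ->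
  continuous (fun z : R * 'rV[R]_n => h (clamp z.1) z.2).
Proof.
move=> t1T ch.
apply: (@continuous_within_comp _ _ _ (fun z => (clamp z.1, z.2)) (fun z => h z.1 z.2)
  (strip T)) => //.
  move=> z A [[P Q] [/= nP nQ] PQA]; exists (clamp @^-1` P, Q) => /=.
    by split => //; exact: continuous_clamp nP.
  by move=> [s y] [/= Ps Qy]; exact: PQA.
move=> z; have /andP[? ct] := clamp_itv z.1; split => //=.
by rewrite (le_lt_trans _ t1T)// lee_fin.
Qed.

Lemma continuous_clamp_half (g : R -> R) : {within `[0, +oo[, continuous g} ->
  continuous (fun t => g (clamp t)).
Proof.
move=> cg; apply: continuous_within_comp cg; first exact: continuous_clamp.
by move=> t; rewrite /= in_itv/= andbT; have /andP[] := clamp_itv t.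
Qed.

End clamp.

(** * Primitives of functions on the half-line *)

Section primitive.
Context {R : realType}.
Variable g : R -> R.
Hypothesis cg : {within `[0, +oo[, continuous g}.

Lemma primitive0_at0 : primitive0 g 0 = 0.
Proof. by rewrite /primitive0 set_itv1 Rintegral_set1. Qed.

Let int_g t : (@lebesgue_measure R).-integrable `[0, t] (EFin \o g).
Proof.
apply: continuous_compact_integrable; first exact: segment_compact.
by apply: continuous_subspaceW cg => x; rewrite /= !in_itv/= => /andP[->].
Qed.

Lemma half_continuous_at t : 0 < t -> {for t, continuous g}.
Proof.
move=> t0; have t10 : 0 < t + 1 by rewrite addr_gt0.
have c := continuous_clamp_half t10 cg.
have -> : {for t, continuous g} = (g s @[s --> t] --> g (clamp (t + 1) t)).
  by rewrite clampE// ltW//= lerDl.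
apply: cvg_trans (c t); apply: near_eq_cvg; near=> s.
rewrite clampE//; apply/andP; split; apply: ltW; near: s; first exact: lt_nbhsr.
by apply: lt_nbhsl; rewrite ltrDl.
Unshelve. all: end_near. Qed.

Lemma is_derive_primitive0 (t : R) : 0 < t -> is_derive t 1 (primitive0 g) (g t).
Proof.
move=> t0; have [||||d1 d2] := @continuous_FTC1_closed _ g 0 t (t + 1).
- by rewrite ltrDl.
- exact: int_g.
- exact: t0.
- exact: half_continuous_at.
- by apply: DeriveDef; [exact: d1|rewrite -derive1E].
Qed.

Lemma primitive0_continuous t1 : 0 < t1 -> {within `[0, t1], continuous (primitive0 g)}.
Proof. by move=> t10; apply: parameterized_integral_continuous; [exact: ltW|exact: int_g]. Qed.

Lemma continuous_clamp_primitive0 t1 : 0 < t1 ->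
  continuous (fun t => primitive0 g (clamp t1 t)).
Proof.
move=> t10; apply: continuous_within_comp (primitive0_continuous t10).
  exact: continuous_clamp.
by move=> t; rewrite /= in_itv/= clamp_itv.
Qed.

Hypothesis g0 : forall t, 0 <= t -> 0 <= g t.

Lemma primitive0_homo s t : 0 <= s -> s <= t -> primitive0 g s <= primitive0 g t.
Proof.
move=> s0; rewrite le_eqVlt => /predU1P[->//|st].
have t0 : 0 < t by exact: le_lt_trans st.
apply: (@ger0_derive1_ndecr _ (primitive0 g) 0 t) => //; last 2 first.
- exact: primitive0_continuous.
- exact: ltW.
- by move=> x; rewrite in_itv/= => /andP[x0 _]; have [] := is_derive_primitive0 x0.
- move=> x; rewrite in_itv/= => /andP[x0 _]; rewrite derive1E.
  by have [_ ->] := is_derive_primitive0 x0; rewrite g0// ltW.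
Qed.

End primitive.

Lemma continuous_itv_bounded {R : realType} (q : R -> R) (a b : R) : continuous q ->
  exists2 C, 0 <= C & forall t, a <= t <= b -> `|q t| <= C.
Proof.
move=> cq; have /compact_bounded[C [_ hC]] :=
  continuous_compact (continuous_subspaceT cq : {within _, continuous _}) (@segment_compact _ a b).
exists (`|C| + 1); first by rewrite addr_ge0.
move=> t tab; apply: (hC (`|C| + 1)).
  by rewrite (le_lt_trans (ler_norm _))// ltrDl.
by exists t => //=; rewrite in_itv.
Qed.

(** E(t) e^(-K t) is nonincreasing, whatever the sign of K. *)
Lemma Gronwall_le0 {R : realType} (E dE : R -> R) (K t0 : R) : 0 < t0 ->
  {within `[0, t0], continuous E} -> (forall t : R, 0 < t < t0 -> is_derive t 1 E (dE t)) ->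
  (forall t, 0 < t < t0 -> dE t <= K * E t) -> E 0 <= 0 -> E t0 <= 0.
Proof.
move=> t00 cE dE' EK E0.
have dF t : 0 < t < t0 -> is_derive t 1 (fun t => E t * expR (- K * t))
    (E t * (expR (- K * t) * - K) + expR (- K * t) * dE t).
  by move=> h; exact: is_derive_mul (dE' _ h) (is_derive_expRM (- K) t).
have : E t0 * expR (- K * t0) <= E 0 * expR (- K * 0).
  apply: (@ler0_derive1_nincr _ (fun t => E t * expR (- K * t)) 0 t0) => //.
  - by move=> t; rewrite in_itv/= => h; have [] := dF t h.
  - move=> t; rewrite in_itv/= => h; rewrite derive1E; have [_ ->] := dF t h.
    have := EK _ h; rewrite -(ler_pM2l (expR_gt0 (- K * t))); lra.
  - move=> t; apply: cvgM; first exact: cE.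
    by apply: (continuous_subspaceT (f := fun s => expR (- K * s))); exact: continuous_expRM.
  - exact: ltW.
rewrite mulr0 expR0 mulr1 => h.
by have := le_trans h E0; rewrite pmulr_lle0// expR_gt0.
Qed.

(** * Finite speed of propagation *)

Section finite_speed.
Context {R : realType} {n : nat}.
(** [ut], [utt], [ui i], [uti i], [uii i] stand for the clamped u_t, u_tt, d_i u, d_i u_t, d_i^2 u.
    The symmetry of mixed derivatives is built in: [uti] is both the time derivative of [ui] and the
    space derivative of [ut]. *)
Variables (p t1 r : R) (a a' b A : R -> R).
Variables (ut utt : R -> 'rV[R]_n -> R) (ui uti uii : 'I_n -> R -> 'rV[R]_n -> R).
Local Notation jointly_continuous h := (continuous (fun z : R * 'rV[R]_n => h z.1 z.2)).
Hypotheses (p1 : 1 < p) (t1_gt0 : 0 < t1).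
Hypotheses (cut : jointly_continuous ut) (cutt : jointly_continuous utt).
Hypotheses (cui : forall i, jointly_continuous (ui i))
  (cuti : forall i, jointly_continuous (uti i))
  (cuii : forall i, jointly_continuous (uii i)).
Hypotheses (ca : continuous a) (ca' : continuous a') (cb : continuous b) (cA : continuous A).
Hypotheses (a_gt0 : forall t, 0 < a t) (A0 : A 0 = 0)
  (A_homo : forall s t, s <= t -> A s <= A t) (A_le : forall t, 0 <= A t <= A t1).
Hypothesis dA : forall t : R, 0 < t < t1 -> is_derive t 1 A (a t).
Hypothesis da : forall t : R, 0 < t < t1 -> is_derive t 1 a (a' t).
Hypothesis dut : forall (t : R) x, 0 < t < t1 -> is_derive t 1 (ut ^~ x) (utt t x).
Hypothesis dui : forall i (t : R) x, 0 < t < t1 -> is_derive t 1 (ui i ^~ x) (uti i t x).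
Hypothesis sut : forall i (t : R) x, 0 < t < t1 ->
  is_derive x (delta_mx 0 i) (ut t) (uti i t x).
Hypothesis sui : forall i (t : R) x, 0 < t < t1 ->
  is_derive x (delta_mx 0 i) (ui i t) (uii i t x).
Hypothesis wave : forall t x, 0 < t < t1 ->
  utt t x = a t ^+ 2 * (\sum_i uii i t x) + b t * ut t x + `|ut t x| `^ p.
Hypothesis init : forall (k : 'I_n) (x : 'rV[R]_n), r < `|x 0 k| ->
  ut 0 x = 0 /\ forall i, ui i 0 x = 0.

Section cone.
(** The cone is cut at time t0, before its apex, where c still has room B - A(t0) > 0. Its base is
    the ball of radius B about c, inside which |x_k| > r, so the initial data vanish there. *)
Variables (t0 B : R) (c : 'rV[R]_n) (k : 'I_n).
Hypotheses (t0_gt0 : 0 < t0) (t0t1 : t0 <= t1) (AB : A t0 < B) (Bc : B + r < `|c 0 k|).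

Let energy t x : R := (ut t x ^+ 2 + a t ^+ 2 * \sum_i ui i t x ^+ 2) / 2.

(* Positive exactly inside the backward light cone of radius B - A(t) about c. *)
Let D t (x : 'rV[R]_n) : R := (B - A t) ^+ 2 - \sum_j (x 0 j - c 0 j) ^+ 2.
Let P t x : R := pos_part (D t x).
Let g t x : R := energy t x * P t x ^+ 2.
(** The summands 0 are those produced by the derivative rules; they make [dD_time] hold by
    conversion. *)
Let dD (t : R) : R := 2 * (B - A t) * (0 - a t) - 0.
Let denergy t x : R :=
  ut t x * utt t x + a t ^+ 2 * (\sum_i ui i t x * uti i t x)
   + a t * a' t * \sum_i ui i t x ^+ 2.
Let h t x : R := energy t x * (2 * P t x * dD t) + P t x ^+ 2 * denergy t x.
(** The energy flux u_t grad u, cut off by P^2. Its divergence has zero integral, so it may be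
    subtracted from [h] to remove the second-order terms. *)
Let flux (i : 'I_n) t x : R := ut t x * ui i t x * P t x ^+ 2.
Let dflux (i : 'I_n) t x : R :=
  ut t x * ui i t x * (2 * P t x * - (2 * (x 0 i - c 0 i)))
  + P t x ^+ 2 * (ut t x * uii i t x + ui i t x * uti i t x).

Let cD : jointly_continuous D.
Proof.
apply: continuous_sub.
  apply: continuous_pow; apply: continuous_sub; first exact: continuous_const.
  by apply: (continuous_compose (f := fst)) => // z; exact: cvg_fst.
apply: continuous_sum => j; apply: continuous_pow.
apply: continuous_sub; last exact: continuous_const.
apply: (continuous_compose (f := snd) (g := fun y : 'rV[R]_n => y 0 j)).
  by move=> z; exact: cvg_snd.
exact: coord_continuous.
Qed.

Let cP : jointly_continuous P.
Proof. by apply: (continuous_compose cD); exact: continuous_pos_part. Qed.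

Let ctime (q : R -> R) : continuous q -> jointly_continuous (fun t (_ : 'rV[R]_n) => q t).
Proof. by move=> cq; apply: (continuous_compose (f := fst)) => // z; exact: cvg_fst. Qed.

Let cenergy : jointly_continuous energy.
Proof.
apply: continuous_mul; last exact: continuous_const.
apply: continuous_add; first exact: continuous_pow.
apply: continuous_mul; first by apply: continuous_pow; exact: ctime.
by apply: continuous_sum => i; exact: continuous_pow.
Qed.

Let cg : jointly_continuous g.
Proof. by apply: continuous_mul => //; exact: continuous_pow. Qed.

Let ch : jointly_continuous h.
Proof.
apply: continuous_add; apply: continuous_mul => //.
- apply: continuous_mul; first by apply: continuous_mul => //; exact: continuous_const.
  apply: (ctime (q := dD)); apply: continuous_sub; last exact: continuous_const.
  apply: continuous_mul; last by apply: continuous_sub => //; exact: continuous_const.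
  apply: continuous_mul; first exact: continuous_const.
  by apply: continuous_sub => //; exact: continuous_const.
- exact: continuous_pow.
- apply: continuous_add; last first.
    apply: continuous_mul; first by apply: continuous_mul; exact: ctime.
    by apply: continuous_sum => i; exact: continuous_pow.
  apply: continuous_add; first exact: continuous_mul.
  apply: continuous_mul; first by apply: continuous_pow; exact: ctime.
  by apply: continuous_sum => i; exact: continuous_mul.
Qed.

Let cdflux i : jointly_continuous (dflux i).
Proof.
apply: continuous_add; apply: continuous_mul.
- exact: continuous_mul.
- apply: continuous_mul; first by apply: continuous_mul => //; exact: continuous_const.
  rewrite (_ : (fun _ => _) = (fun z : R * 'rV[R]_n => -2 * (z.2 0 i - c 0 i))); last first.
    by apply/funext => z; ring.
  apply: continuous_mul; first exact: continuous_const.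
  apply: continuous_sub; last exact: continuous_const.
  apply: (continuous_compose (f := snd) (g := fun y : 'rV[R]_n => y 0 i)).
    by move=> z; exact: cvg_snd.
  exact: coord_continuous.
- exact: continuous_pow.
- by apply: continuous_add; exact: continuous_mul.
Qed.

(** B + A(t1) bounds |B - A(t)| at all times, including those past the apex, where B - A(t) is
    negative and D becomes positive again near c. *)
Let M := \sum_j `|c 0 j| + (B + A t1).

Let P0 t x : ~ cube M x -> P t x = 0.
Proof.
move=> /existsNP[j /negP]; rewrite -ltNge => Mj; apply: le0_pos_part.
rewrite subr_le0 (bigD1 j)//= -[leLHS]addr0 lerD ?sumr_ge0// => [|i _]; last exact: sqr_ge0.
have cj : `|c 0 j| <= \sum_j `|c 0 j| by rewrite (bigD1 j)//= lerDl sumr_ge0.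
have /andP[? ?] := A_le t.
rewrite -(real_normK (num_real (B - _))) -(real_normK (num_real (x 0 j - _))).
rewrite ler_sqr ?nnegrE//.
have := lerB_dist (x 0 j) (c 0 j); move: Mj; rewrite /M => Mj.
have B0 : 0 <= B by have /andP[? _] := A_le t0; have := AB; lra.
have : `|B - A t| <= B + A t1 by rewrite ler_norml; lra.
lra.
Qed.

Let dD_time (t : R) x : 0 < t < t1 -> is_derive t 1 (D ^~ x) (dD t).
Proof.
move=> ht; exact: (is_derive_sub (is_derive_sqr (is_derive_sub (is_derive_const B t 1) (dA ht)))
  (is_derive_const (\sum_j (x 0 j - c 0 j) ^+ 2) t 1)).
Qed.

Let dD_space i t x : is_derive x (delta_mx 0 i) (D t) (- (2 * (x 0 i - c 0 i))).
Proof.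
have := is_derive_sub (is_derive_const ((B - A t) ^+ 2) x (delta_mx 0 i))
  (is_derive_bigsum (fun j => is_derive_sqr (is_derive_sub (is_derive_coord i j x)
    (is_derive_const (c 0 j) x (delta_mx 0 i))))).
rewrite (bigD1 i)//= eqxx big1 ?addr0 => [|j /negPf ji]; last first.
  by rewrite eq_sym ji subr0 mulr0.
by rewrite subr0 mulr1 sub0r.
Qed.

Let dg_time (t : R) x : 0 < t < t1 -> is_derive t 1 (g ^~ x) (h t x).
Proof.
move=> ht.
have dE : is_derive t 1 (energy ^~ x) (denergy t x).
  have de := is_derive_add (is_derive_sqr (dut x ht))
    (is_derive_mul (is_derive_sqr (da ht))
      (is_derive_bigsum (fun i => is_derive_sqr (dui i x ht)))).
  apply: (is_derive_eq (is_derive_mul de (is_derive_const 2^-1 t 1))).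
  rewrite mulr0 add0r /denergy.
  have -> : \sum_i 2 * ui i t x * uti i t x = 2 * \sum_i ui i t x * uti i t x.
    by rewrite mulr_sumr; apply: eq_bigr => i _; rewrite mulrA.
  by field.
exact: is_derive_mul dE (is_derive_chain (dD_time x ht) (is_derive_pos_part_sqr (D t x))).
Qed.

Let dflux_space i (t : R) x : 0 < t < t1 ->
  is_derive x (delta_mx 0 i) (flux i t) (dflux i t x).
Proof.
move=> ht; apply: is_derive_mul; first exact: (is_derive_mul (sut i x ht) (sui i x ht)).
apply: (@is_derive_chain _ _ (D t) (fun s => pos_part s ^+ 2)); first exact: dD_space.
exact: is_derive_pos_part_sqr.
Qed.

Let integral_dflux i t : 0 < t < t1 -> integral_rV (dflux i t) = 0.
Proof.
move=> ht; have E : dflux i t = partial i (flux i t).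
  by apply/funext => x; have [_ <-] := dflux_space i x ht.
rewrite E; apply: (@integral_rV_partial _ _ _ _ M) => [x||x Mx].
- by have [] := dflux_space i x ht.
- by rewrite -E; exact: continuous_slice_rV.
- by rewrite /flux P0// expr0n mulr0.
Qed.

Let S2 t x := \sum_i ui i t x ^+ 2.
Let Sy t (x : 'rV[R]_n) := \sum_i ui i t x * (x 0 i - c 0 i).

Let sum_dflux t x : \sum_i dflux i t x = - 4 * P t x * ut t x * Sy t x
  + P t x ^+ 2 * (ut t x * (\sum_i uii i t x) + \sum_i ui i t x * uti i t x).
Proof.
rewrite /Sy mulrDr !mulr_sumr -!big_split/=; apply: eq_bigr => i _; rewrite /dflux; ring.
Qed.

(** By the equation, the terms in u_t Laplacian(u) and grad u . grad u_t cancel. The first summand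
    left comes from the shrinking of the cone and has a sign by [flux_le]; the second is of lower
    order. *)
Let balance t x : 0 < t < t1 -> h t x - a t ^+ 2 * \sum_i dflux i t x =
  4 * P t x * a t * (a t * ut t x * Sy t x - (B - A t) * energy t x)
  + P t x ^+ 2 * (ut t x * (b t * ut t x + `|ut t x| `^ p) + a t * a' t * S2 t x).
Proof.
by move=> ht; rewrite sum_dflux /h /denergy wave// /dD /S2; ring.
Qed.

(** With L = B - A(t) and y = x - c, expanding the sum of the squares (a L d_i u - u_t y_i)^2 and
    using |y| <= L gives Cauchy-Schwarz and the arithmetic-geometric inequality at once. *)
Let flux_le t (x : 'rV[R]_n) : 0 < B - A t -> \sum_j (x 0 j - c 0 j) ^+ 2 <= (B - A t) ^+ 2 ->
  a t * ut t x * Sy t x <= (B - A t) * energy t x.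
Proof.
move=> L0 yL; set L := B - A t.
have : 0 <= \sum_i (a t * L * ui i t x - ut t x * (x 0 i - c 0 i)) ^+ 2.
  by apply: sumr_ge0 => i _; exact: sqr_ge0.
have -> : \sum_i (a t * L * ui i t x - ut t x * (x 0 i - c 0 i)) ^+ 2 =
    (a t * L) ^+ 2 * S2 t x + (- 2 * a t * L * ut t x) * Sy t x
     + ut t x ^+ 2 * \sum_j (x 0 j - c 0 j) ^+ 2.
  rewrite /S2 /Sy !mulr_sumr -!big_split/=; apply: eq_bigr => i _; ring.
have := ler_wpM2l (sqr_ge0 (ut t x)) yL; rewrite -/L => h1 h2.
rewrite -(ler_pM2l (_ : 0 < 2 * L)) ?mulr_gt0//.
have -> : 2 * L * (L * energy t x) = L ^+ 2 * ut t x ^+ 2 + (a t * L) ^+ 2 * S2 t x.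
  by rewrite /energy -/(S2 t x); field.
lra.
Qed.

Let cone_ineq : exists K, forall t x, 0 < t < t0 ->
  h t x - a t ^+ 2 * \sum_i dflux i t x <= K * g t x.
Proof.
(* The bound on |u_t| makes the nonlinearity linear: u_t |u_t|^p <= Cu^(p-1) u_t^2. The constants
   depend on the solution, which is harmless as only the vanishing of the energy is sought. *)
have [Cu Cu0 hu] := slab_bounded M 0 t1 cut.
have [Cb Cb0 hb] := continuous_itv_bounded 0 t1 cb.
have caa : continuous (fun t => a' t / a t).
  apply: continuous_mul => // t; apply: cvgV; first by rewrite gt_eqF.
  exact: ca.
have [Ca Ca0 ha] := continuous_itv_bounded 0 t1 caa.
(* [Ca] bounds a'/a, since a a' |grad u|^2 = (a'/a) a^2 |grad u|^2; the factor 2 offsets the 1/2 in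
   [energy]. *)
exists (2 * (Cb + Cu `^ (p - 1) + Ca)) => t x /andP[tpos tt0].
have ht : 0 < t < t1 by rewrite tpos (lt_le_trans tt0).
have htc : 0 <= t <= t1 by case/andP : ht => ? ?; rewrite !ltW.
have L0 : 0 < B - A t by rewrite subr_gt0 (le_lt_trans _ AB)// A_homo// ltW.
rewrite balance//.
have [D0|D0] := leP (D t x) 0.
  by rewrite /g /P le0_pos_part// expr0n !(mulr0, mul0r, addr0).
have cubex : cube M x.
  apply: contrapT => /P0 => /(_ t); rewrite /P ge0_pos_part ?ltW// => D0'.
  by move: D0; rewrite D0' ltxx.
have P00 : 0 <= P t x by exact: pos_part_ge0.
have e0 : 0 <= energy t x.
  rewrite divr_ge0// addr_ge0 ?sqr_ge0// mulr_ge0 ?sqr_ge0//.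
  by apply: sumr_ge0 => i _; exact: sqr_ge0.
have F1 : 4 * P t x * a t * (a t * ut t x * Sy t x - (B - A t) * energy t x) <= 0.
  apply: mulr_ge0_le0; first by apply: mulr_ge0; [exact: mulr_ge0|exact: ltW].
  rewrite subr_le0 flux_le//; move: D0; rewrite /D subr_gt0; exact: ltW.
have F2 : ut t x * (b t * ut t x + `|ut t x| `^ p) + a t * a' t * S2 t x <=
    2 * (Cb + Cu `^ (p - 1) + Ca) * energy t x.
  have S20 : 0 <= S2 t x by apply: sumr_ge0 => i _; exact: sqr_ge0.
  have b1 : b t * ut t x ^+ 2 <= Cb * ut t x ^+ 2.
    by rewrite ler_wpM2r ?sqr_ge0// (le_trans (ler_norm _))// hb.
  have b2 : a t * a' t * S2 t x <= Ca * (a t ^+ 2 * S2 t x).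
    have -> : a t * a' t * S2 t x = (a' t / a t) * (a t ^+ 2 * S2 t x).
      by field; rewrite gt_eqF.
    apply: ler_wpM2r; first by apply: mulr_ge0 => //; exact: sqr_ge0.
    exact: le_trans (ler_norm _) (ha t htc).
  have b3 : ut t x * `|ut t x| `^ p <= Cu `^ (p - 1) * ut t x ^+ 2.
    apply: (@le_trans _ _ (`|ut t x| * `|ut t x| `^ p)).
      by rewrite ler_wpM2r ?powR_ge0// ler_norm.
    rewrite -(mulr_powRB1 (normr_ge0 (ut t x))) ?(lt_trans _ p1)// mulrA mulrC.
    rewrite -expr2 real_normK ?num_real// ler_wpM2r ?sqr_ge0//.
    by rewrite ge0_ler_powR ?nnegrE ?subr_ge0 ?(ltW p1)//; exact: hu.
  have -> : 2 * (Cb + Cu `^ (p - 1) + Ca) * energy t x =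
      (Cb + Cu `^ (p - 1) + Ca) * (ut t x ^+ 2 + a t ^+ 2 * S2 t x).
    by rewrite /energy -/(S2 t x); field.
  have aS : 0 <= a t ^+ 2 * S2 t x by rewrite mulr_ge0 ?sqr_ge0.
  have c1 : 0 <= (Cb + Cu `^ (p - 1)) * (a t ^+ 2 * S2 t x).
    by rewrite mulr_ge0// addr_ge0// powR_ge0.
  have c2 : 0 <= Ca * ut t x ^+ 2 by rewrite mulr_ge0// sqr_ge0.
  have -> : ut t x * (b t * ut t x + `|ut t x| `^ p) =
      b t * ut t x ^+ 2 + ut t x * `|ut t x| `^ p by ring.
  lra.
have := ler_wpM2l (sqr_ge0 (P t x)) F2; rewrite /g; lra.
Qed.

Let g0 t x : ~ cube M x -> g t x = 0.
Proof. by move=> Mx; rewrite /g P0// expr0n mulr0. Qed.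

Let h0 t x : ~ cube M x -> h t x = 0.
Proof. by move=> Mx; rewrite /h P0// expr0n !(mulr0, mul0r, addr0). Qed.

Let dflux0 i t x : ~ cube M x -> dflux i t x = 0.
Proof. by move=> Mx; rewrite /dflux P0// expr0n !(mulr0, mul0r, addr0). Qed.

(** Where the weight is positive, |x_k - c_k| < B, hence |x_k| > |c_k| - B > r and the data
    vanish. *)
Let energy_initial x : g 0 x = 0.
Proof.
have [D0|D0] := leP (D 0 x) 0; first by rewrite /g /P le0_pos_part// expr0n mulr0.
suff rx : r < `|x 0 k|.
  rewrite /g /energy; have [-> ui0] := init rx.
  by rewrite big1 => [|i _]; rewrite ?ui0 expr0n// mulr0 addr0 !mul0r.
have B0 : 0 < B by rewrite (le_lt_trans _ AB)//; have /andP[] := A_le t0.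
have : (x 0 k - c 0 k) ^+ 2 < B ^+ 2.
  move: D0; rewrite /D A0 subr0 subr_gt0; apply: le_lt_trans.
  by rewrite (bigD1 k)//= lerDl sumr_ge0// => i _; exact: sqr_ge0.
rewrite -real_normK ?num_real// ltr_sqr ?nnegrE ?(ltW B0)// => xcB.
have := lerB_dist (c 0 k) (x 0 k); rewrite distrC; have := Bc; lra.
Qed.

Lemma cone_vanishing : ut t0 c = 0 /\ forall i, ui i t0 c = 0.
Proof.
have g_ge0 t x : 0 <= g t x.
  rewrite mulr_ge0 ?sqr_ge0// divr_ge0// addr_ge0 ?sqr_ge0// mulr_ge0 ?sqr_ge0//.
  by apply: sumr_ge0 => i _; exact: sqr_ge0.
have [K hK] := cone_ineq.
have E0 : integral_rV (g t0) <= 0.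
  apply: (@Gronwall_le0 _ (fun t => integral_rV (g t)) (fun t => integral_rV (h t)) K) => //.
  - by apply: continuous_subspaceT; apply: (continuous_integral_rV cg g0).
  - move=> t /andP[tpos tt0].
    apply: (is_derive_integral_rV cg ch g0 (u := 0) (v := t1)).
    - by move=> s x hs; exact: dg_time.
    - exact: h0.
    - by rewrite tpos (lt_le_trans tt0).
  - move=> t ht; have ht1 : 0 < t < t1.
      by case/andP : ht => -> tt0; rewrite (lt_le_trans tt0).
    have cs (q : R -> 'rV[R]_n -> R) : jointly_continuous q -> continuous (q t).
      by move=> cq; exact: continuous_slice_rV.
    have csum : continuous (fun x => \sum_i dflux i t x).
      by apply: continuous_sum => i; apply: cs.
    have Isum : integral_rV (fun x => \sum_i dflux i t x) = 0.
      rewrite (@integral_rV_sum _ _ _ _ _ M) => [|i|i x]; last exact: dflux0.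
        by rewrite big1// => i _; exact: integral_dflux.
      by apply: cs.
    have sum0 x : ~ cube M x -> \sum_i dflux i t x = 0.
      by move=> Mx; rewrite big1// => i _; exact: dflux0.
    (* The flux term added here has zero integral; the new integrand obeys the pointwise bound K
       g. *)
    have -> : integral_rV (h t) =
        integral_rV (fun x => h t x + (- a t ^+ 2) * \sum_i dflux i t x).
      rewrite (@integral_rVD _ _ _ _ M).
      + by rewrite (@integral_rVZ _ _ _ M)// Isum mulr0 addr0.
      + exact: cs.
      + by apply: continuous_mul => //; exact: continuous_const.
      + exact: h0.
      + by move=> x Mx; rewrite sum0// mulr0.
    rewrite -(@integral_rVZ _ _ _ M); [|exact: cs|exact: g0].
    apply: (@le_integral_rV _ _ _ _ M).
    + by apply: continuous_add; [exact: cs|apply: continuous_mul => //; exact: continuous_const].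
    + by apply: continuous_mul; [exact: continuous_const|exact: cs].
    + by move=> x Mx; rewrite h0// sum0// mulr0 addr0.
    + by move=> x Mx; rewrite g0// mulr0.
    + by move=> x; rewrite mulNr; exact: hK.
  - rewrite (_ : g 0 = fun=> 0) ?integral_rV0//.
    by apply/funext => x; exact: energy_initial.
have {}E0 : integral_rV (g t0) = 0.
  by apply/eqP; rewrite eq_le E0/=; apply: integral_rV_ge0.
have := integral_rV_eq0 (continuous_slice_rV cg (t := t0)) (@g0 t0) (g_ge0 t0) E0 c.
(* The weight is positive at (t0, c), so the energy density itself vanishes there, and a(t0) > 0
   separates u_t from the gradient. *)
have L0 : 0 < B - A t0 by rewrite subr_gt0.
have DL : D t0 c = (B - A t0) ^+ 2.
  by rewrite /D big1 ?subr0// => j _; rewrite subrr expr0n.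
rewrite /g /P DL ge0_pos_part ?sqr_ge0// => /eqP.
rewrite mulf_eq0 [X in _ || X]expf_eq0/= [X in _ || X]expf_eq0/= (gt_eqF L0) orbF.
rewrite mulf_eq0 invr_eq0 pnatr_eq0 orbF.
have S20 : 0 <= \sum_i ui i t0 c ^+ 2 by apply: sumr_ge0 => i _; exact: sqr_ge0.
have aS : 0 <= a t0 ^+ 2 * \sum_i ui i t0 c ^+ 2 by apply: mulr_ge0 => //; exact: sqr_ge0.
rewrite paddr_eq0 ?sqr_ge0// => /andP[].
rewrite expf_eq0/= => /eqP ->; rewrite mulf_eq0 expf_eq0/= (gt_eqF (a_gt0 t0))/=.
rewrite psumr_eq0 => [|i _]; last exact: sqr_ge0.
move=> /allP h2; split => // i; have := h2 i (mem_index_enum _).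
by rewrite expf_eq0/= => /eqP.
Qed.

End cone.

Lemma finite_speed (t : R) (c : 'rV[R]_n) (k : 'I_n) : 0 <= t <= t1 ->
  A t + r < `|c 0 k| -> ut t c = 0 /\ forall i, ui i t c = 0.
Proof.
rewrite le_eqVlt => /andP[/predU1P[<-|t0] tt1] Ak.
  by apply: (init (k := k)); rewrite -(add0r r) -A0.
(* The midpoint of A(t) and |c_k| - r satisfies both strict inequalities required of [B]. *)
apply: (@cone_vanishing t ((A t + (`|c 0 k| - r)) / 2) c k) => //; lra.
Qed.

Hypothesis r0 : 0 < r.
Hypothesis ut_clamp : forall t x, ut t x = ut (clamp t1 t) x.

Let cube_radius t := A t + r.

Let radius_le t : cube_radius t <= cube_radius t1.
Proof. by rewrite lerD2r; have /andP[] := A_le t. Qed.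

Lemma support_ut t x : 0 <= t <= t1 -> ~ cube (cube_radius t) x ->
  ut t x = 0 /\ forall i, ui i t x = 0.
Proof.
by move=> ht /existsNP[k /negP]; rewrite -ltNge => kx; exact: (finite_speed (k := k)).
Qed.

Let ut0 t x : ~ cube (cube_radius t1) x -> ut t x = 0.
Proof.
move=> nx; rewrite ut_clamp.
suff /support_ut[] : ~ cube (cube_radius (clamp t1 t)) x by [|exact: clamp_itv].
by move=> h; apply: nx => i; exact: le_trans (h i) (radius_le _).
Qed.

Lemma continuous_mean : continuous (fun t => integral_rV (ut t)).
Proof. exact: (continuous_integral_rV cut ut0). Qed.

(** Integrate the equation over x: each d_i^2 u is a partial derivative of the compactly supported
    d_i u, so the Laplacian contributes nothing. *)
Lemma is_derive_mean (t : R) : 0 < t < t1 ->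
  is_derive t 1 (fun t => integral_rV (ut t))
    (b t * integral_rV (ut t) + integral_rV (fun x => `|ut t x| `^ p)).
Proof.
move=> ht; have htc : 0 <= t <= t1 by case/andP : ht => ? ?; rewrite !ltW.
have nx x : ~ cube (cube_radius t1) x -> ~ cube (cube_radius t) x.
  by move=> h1 h2; apply: h1 => i; exact: le_trans (h2 i) (radius_le _).
have ui0 i x : ~ cube (cube_radius t1) x -> ui i t x = 0.
  by move=> /nx/(support_ut htc)[_].
have uiiE i : uii i t = partial i (ui i t).
  by apply/funext => x; have [_ <-] := sui i x ht.
have uii0 i x : ~ cube (cube_radius t1) x -> uii i t x = 0.
  by rewrite uiiE; apply: (partial_off_cube i (@ui0 i)).
have Iuii i : integral_rV (uii i t) = 0.
  rewrite uiiE; apply: (@integral_rV_partial _ _ _ _ (cube_radius t1)) => [x||x].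
  - by have [] := sui i x ht.
  - by rewrite -uiiE; exact: (continuous_slice_rV (@cuii i)).
  - exact: ui0.
have p0 : 0 < p by exact: lt_trans p1.
have utp0 x : ~ cube (cube_radius t1) x -> `|ut t x| `^ p = 0.
  by move=> h; rewrite ut0// normr0 powR0// gt_eqF.
have cutp : continuous (fun x => `|ut t x| `^ p).
  apply: (continuous_compose (f := ut t) (g := fun y => `|y| `^ p)).
    exact: continuous_slice_rV.
  exact: continuous_norm_powR.
have csum : continuous (fun x => \sum_i uii i t x).
  by apply: continuous_sum => i; exact: (continuous_slice_rV (@cuii i)).
have sum0 x : ~ cube (cube_radius t1) x -> \sum_i uii i t x = 0.
  by move=> h; rewrite big1// => i _; exact: uii0.
have cutt' : continuous (ut t) by exact: continuous_slice_rV.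
have cmul (q : R) (f : 'rV[R]_n -> R) : continuous f -> continuous (fun x => q * f x).
  by move=> cf; apply: continuous_mul => //; exact: continuous_const.
have <- : integral_rV (utt t) = b t * integral_rV (ut t) + integral_rV (fun x => `|ut t x| `^ p).
  have -> : utt t = fun x => (a t ^+ 2 * (\sum_i uii i t x) + b t * ut t x) + `|ut t x| `^ p.
    by apply/funext => x; exact: wave.
  rewrite (@integral_rVD _ _ _ _ (cube_radius t1))//; last 2 first.
  - by apply: continuous_add; exact: cmul.
  - by move=> x hx; rewrite sum0// ut0// !mulr0 addr0.
  rewrite (@integral_rVD _ _ _ _ (cube_radius t1)); last 4 first.
  - exact: cmul.
  - exact: cmul.
  - by move=> x hx; rewrite sum0// mulr0.
  - by move=> x hx; rewrite ut0// mulr0.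
  rewrite (@integral_rVZ _ _ _ (cube_radius t1))//.
  rewrite (@integral_rVZ _ _ _ (cube_radius t1))//; last exact: ut0.
  rewrite (@integral_rV_sum _ _ _ _ _ (cube_radius t1)); last 2 first.
  - by move=> i; exact: (continuous_slice_rV (@cuii i)).
  - exact: uii0.
  by rewrite big1 ?mulr0 ?add0r.
apply: (is_derive_integral_rV cut cutt ut0 (u := 0) (v := t1)) => //.
by move=> x hx; rewrite wave// sum0// ut0// !mulr0 !add0r normr0 powR0// gt_eqF.
Qed.

Lemma mean_powR_le t : 0 <= t <= t1 -> 0 < integral_rV (ut t) ->
  ((cube_radius t *+ 2) ^+ n) `^ (1 - p) * integral_rV (ut t) `^ p <=
  integral_rV (fun x => `|ut t x| `^ p).
Proof.
move=> ht G0; apply: Jensen_rV => //.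
- by have /andP[? _] := A_le t; rewrite ltr_wpDl.
- exact: continuous_slice_rV.
- by move=> x /(support_ut ht)[].
Qed.

End finite_speed.

(** * The differential inequality for the mean *)

Section blow_up.
Context {R : realType}.
(** [B] is a primitive of [b], and [W] a primitive of some minorant of the exponential weight.
    Leaving [W] free serves both regimes: W(t) = t, and W(t) = (e^(q t) - 1) / q with q = (beta -
    alpha)(p - 1). *)
Variables (p t1 alpha beta kappa : R) (b G F W dW B : R -> R).
Hypotheses (p1 : 1 < p) (t1_gt0 : 0 < t1) (kappa_gt0 : 0 < kappa).
Hypotheses (cG : continuous G) (cW : {within `[0, t1], continuous W})
  (cB : {within `[0, t1], continuous B}).
Hypothesis dG : forall t : R, 0 < t < t1 -> is_derive t 1 G (b t * G t + F t).
Hypothesis dB : forall t : R, 0 < t < t1 -> is_derive t 1 B (b t).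
Hypothesis dW' : forall t : R, 0 < t < t1 -> is_derive t 1 W (dW t).
Hypothesis W0 : W 0 = 0.
Hypothesis dW_le : forall t, 0 < t < t1 -> dW t <= expR ((beta - alpha) * (p - 1) * t).
Hypothesis b_ge : forall t, 0 < t < t1 -> beta <= b t.
Hypothesis F_ge0 : forall t, 0 < t < t1 -> 0 <= F t.
Hypothesis F_ge : forall t, 0 < t < t1 -> 0 < G t ->
  kappa * expR (- (alpha * (p - 1) * t)) * G t `^ p <= F t.
Hypothesis G0 : 0 < G 0.

Let ndecr (f df : R -> R) : (forall t : R, 0 < t < t1 -> is_derive t 1 f (df t)) ->
  (forall t, 0 < t < t1 -> 0 <= df t) -> {within `[0, t1], continuous f} ->
  forall t, 0 <= t <= t1 -> f 0 <= f t.
Proof.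
move=> df' df0 cf t /andP[t0 tt1]; apply: (@ger0_derive1_ndecr _ f 0 t1) => //.
- by move=> x; rewrite in_itv/= => hx; have [] := df' x hx.
- by move=> x; rewrite in_itv/= => hx; rewrite derive1E; have [_ ->] := df' x hx; exact: df0.
Qed.

(** G e^(-B) is nondecreasing because F >= 0. The exact integrating factor is needed: b >= beta
    gives b G >= beta G only once G >= 0 is known. *)
Let G_gt0 t : 0 <= t <= t1 -> 0 < G t.
Proof.
move=> ht.
have : G 0 * expR (- B 0) <= G t * expR (- B t).
  apply: (@ndecr (fun t => G t * expR (- B t))
    (fun t => G t * (expR (- B t) * - b t) + expR (- B t) * (b t * G t + F t))) => //.
  - move=> s hs; apply: (is_derive_mul (dG hs)).
    exact: (is_derive_chain (is_deriveN (dB hs)) (is_derive_expR _)).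
  - move=> s hs; have -> : G s * (expR (- B s) * - b s) + expR (- B s) * (b s * G s + F s) =
        expR (- B s) * F s by ring.
    by rewrite mulr_ge0 ?expR_ge0// F_ge0.
  - move=> s; apply: cvgM; first exact: (continuous_subspaceT cG).
    by apply: continuous_comp; [apply: cvgN; exact: cB|exact: continuous_expR].
move=> h; have := lt_le_trans (mulr_gt0 G0 (expR_gt0 (- B 0))) h.
by rewrite pmulr_lgt0// expR_gt0.
Qed.

Let H t := expR (- beta * t) * G t.

Let cH : continuous H.
Proof.
by apply: continuous_mul => //; exact: continuous_expRM.
Qed.

Let dH (t : R) : 0 < t < t1 -> is_derive t 1 H
  (expR (- beta * t) * (b t * G t + F t) + G t * (expR (- beta * t) * - beta)).
Proof.
by move=> ht; exact: is_derive_mul (is_derive_expRM (- beta) t) (dG ht).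
Qed.

Let H_gt0 t : 0 <= t <= t1 -> 0 < H t.
Proof. by move=> ht; rewrite mulr_gt0 ?expR_gt0 ?G_gt0. Qed.

(** With G = e^(beta t) H the exponents combine to -beta - alpha (p-1) + beta p = (beta -
    alpha)(p-1). *)
Let dH_ge t : 0 < t < t1 ->
  kappa * expR ((beta - alpha) * (p - 1) * t) * H t `^ p <=
  expR (- beta * t) * (b t * G t + F t) + G t * (expR (- beta * t) * - beta).
Proof.
move=> ht; have htc : 0 <= t <= t1 by case/andP : ht => ? ?; rewrite !ltW.
have Gt := G_gt0 htc.
rewrite /H powRM ?expR_ge0 ?(ltW Gt)// -expRM.
have -> : kappa * expR ((beta - alpha) * (p - 1) * t) * (expR (- beta * t * p) * G t `^ p) =
    expR (- beta * t) * (kappa * expR (- (alpha * (p - 1) * t)) * G t `^ p).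
  have : expR ((beta - alpha) * (p - 1) * t) * expR (- beta * t * p) =
      expR (- beta * t) * expR (- (alpha * (p - 1) * t)).
    by rewrite -!expRD; congr expR; ring.
  by move=> E; ring: E.
have -> : expR (- beta * t) * (b t * G t + F t) + G t * (expR (- beta * t) * - beta) =
  expR (- beta * t) * ((b t - beta) * G t + F t) by ring.
rewrite ler_pM2l ?expR_gt0// (le_trans (F_ge ht Gt))// lerDr.
by rewrite mulr_ge0 ?(ltW Gt)// subr_ge0 b_ge.
Qed.

Lemma is_derive_powR (x q : R) : 0 < x -> is_derive x 1 (@powR R ^~ q) (q * x `^ (q - 1)).
Proof.
move=> x0; have xI : x \in `]0, +oo[ by rewrite in_itv/= x0.
by apply: DeriveDef; [exact: derivable_powR|rewrite -derive1E powR_derive1].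
Qed.

(** K = H^(1-p) + (p-1) kappa W is nonincreasing, and H^(1-p) >= 0 at time t1. *)
Lemma blow_up_bound : (p - 1) * kappa * W t1 <= G 0 `^ (1 - p).
Proof.
pose K t := H t `^ (1 - p) + (p - 1) * kappa * W t.
pose dHt t := expR (- beta * t) * (b t * G t + F t) + G t * (expR (- beta * t) * - beta).
have p10 : 0 < p - 1 by rewrite subr_gt0.
have dK (t : R) : 0 < t < t1 -> is_derive t 1 K
    ((1 - p) * H t `^ (1 - p - 1) * dHt t + ((p - 1) * kappa * dW t + W t * 0)).
  move=> ht; have htc : 0 <= t <= t1 by case/andP : ht => ? ?; rewrite !ltW.
  apply: is_derive_add; last exact: is_derive_mul (is_derive_const _ t 1) (dW' ht).
  exact: (is_derive_chain (dH ht) (is_derive_powR (1 - p) (H_gt0 htc))).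
have dK0 t : 0 < t < t1 ->
    (1 - p) * H t `^ (1 - p - 1) * dHt t + ((p - 1) * kappa * dW t + W t * 0) <= 0.
  move=> ht; have htc : 0 <= t <= t1 by case/andP : ht => ? ?; rewrite !ltW.
  have Hp := powR_gt0 p (H_gt0 htc).
  have -> : 1 - p - 1 = - p by ring.
  rewrite powRN mulr0 addr0.
  set e := expR ((beta - alpha) * (p - 1) * t).
  have h1 : (p - 1) * kappa * e <= (p - 1) * (H t `^ p)^-1 * dHt t.
    have -> : (p - 1) * kappa * e = (p - 1) * (H t `^ p)^-1 * (kappa * e * H t `^ p).
      by field; rewrite gt_eqF.
    rewrite ler_pM2l; first exact: dH_ge.
    by rewrite mulr_gt0// invr_gt0.
  have h2 : (p - 1) * kappa * dW t <= (p - 1) * kappa * e.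
    by rewrite ler_pM2l ?dW_le// mulr_gt0.
  lra.
have cHp : {within `[0, t1], continuous (fun t => H t `^ (1 - p))}.
  apply: continuous_in_subspaceT => t; rewrite inE/= in_itv/= => ht.
  apply: (@continuous_comp _ _ _ H (@powR R ^~ (1 - p))); first exact: cH.
  exact: is_derive_continuous (is_derive_powR _ (H_gt0 ht)).
have : K t1 <= K 0.
  apply: (@ler0_derive1_nincr _ K 0 t1) => //; last exact: ltW.
  - by move=> t; rewrite in_itv/= => ht; have [] := dK t ht.
  - by move=> t; rewrite in_itv/= => ht; rewrite derive1E; have [_ ->] := dK t ht; exact: dK0.
  - move=> t; apply: cvgD; first exact: cHp.
    by apply: cvgM; [exact: cvg_cst|exact: cW].
rewrite /K W0 mulr0 addr0 {2}/H mulr0 expR0 mul1r; apply: le_trans.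
by rewrite lerDr powR_ge0.
Qed.

End blow_up.

(** Restriction to the plane of t and of the line through x in direction e_i reduces this to
    [Schwarz_mixed]. [cl] stands for the clamp, which provides continuity of the mixed derivatives
    for all times. *)
Lemma Schwarz_rV {R : realType} n (i : 'I_n) (v vt vi vti vit : R -> 'rV[R]_n -> R)
    (cl : R -> R) (t1 t : R) (x : 'rV[R]_n) : 0 < t < t1 ->
  (forall t, 0 < t < t1 -> cl t = t) ->
  (forall (s : R) y, 0 < s < t1 -> is_derive s 1 (v ^~ y) (vt s y)) ->
  (forall (s : R) y, 0 < s < t1 -> is_derive y (delta_mx 0 i) (v s) (vi s y)) ->
  (forall (s : R) y, 0 < s < t1 -> is_derive y (delta_mx 0 i) (vt s) (vti s y)) ->
  (forall (s : R) y, 0 < s < t1 -> is_derive s 1 (vi ^~ y) (vit s y)) ->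
  continuous (fun z : R * 'rV[R]_n => vti (cl z.1) z.2) ->
  continuous (fun z : R * 'rV[R]_n => vit (cl z.1) z.2) ->
  vti t x = vit t x.
Proof.
move=> ht clE dv sv svt dvi cvti cvit; pose e : 'rV[R]_n := delta_mx 0 i.
have lineC : continuous (fun z : R * R => (z.1, z.2 *: e + x)).
  have c2 : continuous (fun s : R => s *: e + x).
    by move=> s; apply: cvgD; [exact: scalel_continuous|exact: cvg_cst].
  move=> z B [[P Q] [/= nP nQ] PQB]; exists (P, (fun s : R => s *: e + x) @^-1` Q) => /=.
    by split => //; exact: c2 nQ.
  by move=> [s y] [/= Ps Qy]; exact: PQB.
have := @Schwarz_mixed R (fun t s => v t (s *: e + x)) (fun t s => vt t (s *: e + x))
  (fun t s => vi t (s *: e + x)) (fun t s => vti (cl t) (s *: e + x))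
  (fun t s => vit (cl t) (s *: e + x)) 0 t1 t 0 ht.
rewrite (clE t ht) scale0r add0r; apply.
- move=> s y hs; exact: ((is_derive_line_at (v s) x e y (vi s (y *: e + x))).1 (sv s _ hs)).
- move=> s y hs; rewrite (clE s hs).
  exact: ((is_derive_line_at (vt s) x e y (vti s (y *: e + x))).1 (svt s _ hs)).
- by move=> s y hs; rewrite (clE s hs); exact: dvi.
- exact: (continuous_compose lineC cvti).
- exact: (continuous_compose lineC cvit).
Qed.

(** Gronwall, with rate alpha, applied to the difference E of the two sides: E' - alpha E = (A +
    r)^n ((n+1) a - alpha (A + r)) <= 0. *)
Lemma pow_radius_le {R : realType} (n : nat) (r alpha : R) (a : R -> R) (t : R) :
  0 < r -> {within `[0, +oo[, continuous a} -> (forall t, 0 <= t -> 0 < a t) ->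
  (forall t, 0 <= t -> n.+1%:R * a t / (primitive0 a t + r) <= alpha) -> 0 <= t ->
  (primitive0 a t + r) ^+ n.+1 <= r ^+ n.+1 * expR (alpha * t).
Proof.
move=> r0 ca a0 ha; rewrite le_eqVlt => /predU1P[<-|t0].
  by rewrite primitive0_at0 add0r mulr0 expR0 mulr1.
have A0 s : 0 <= s -> 0 < primitive0 a s + r.
  move=> s0; rewrite ltr_wpDl// -(primitive0_at0 a) primitive0_homo// => y y0.
  exact/ltW/a0.
pose E t := (primitive0 a t + r) ^+ n.+1 - r ^+ n.+1 * expR (alpha * t).
pose dE t := n.+1%:R * (primitive0 a t + r) ^+ n * a t
  - (r ^+ n.+1 * (expR (alpha * t) * alpha) + expR (alpha * t) * 0).
suff : E t <= 0 by rewrite subr_le0.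
apply: (@Gronwall_le0 _ E dE alpha) => //.
- move=> s; apply: cvgB; last first.
    apply: cvgM; first exact: cvg_cst.
    by apply: (continuous_subspaceT (f := fun s => expR (alpha * s))); exact: continuous_expRM.
  apply: (@continuous_comp _ _ _ (primitive0 a : subspace _ -> R) (fun x => (x + r) ^+ n.+1)).
    exact: primitive0_continuous.
  by apply: continuous_pow; apply: continuous_add => [x|]; [exact: cvg_id|exact: continuous_const].
- move=> s /andP[s0 _]; apply: is_derive_sub.
    have := is_derive_add (is_derive_primitive0 ca s0) (is_derive_const r s 1).
    by rewrite addr0; exact: is_derive_pow.
  exact: is_derive_mul (is_derive_const (r ^+ n.+1) s 1) (is_derive_expRM alpha s).
- move=> s /andP[s0 _]; have As := A0 s (ltW s0).
  have := ha s (ltW s0); rewrite ler_pdivrMr// => h.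
  have := ler_wpM2l (exprn_ge0 n (ltW As)) h.
  rewrite /dE /E [(_ + r) ^+ n.+1]exprS.
  by move: (_ ^+ n) (r ^+ n.+1) (expR _) => X Y Z h'; lra.
- by rewrite /E primitive0_at0 add0r mulr0 expR0 mulr1 subrr.
Qed.

(** * Classical solutions *)

Section solution.
Context {R : realType} {n : nat}.
Variables (p r eps t1 : R) (T : \bar R) (u0 u1 : 'rV[R]_n.+1 -> R) (a b : R -> R)
  (u : R -> 'rV[R]_n.+1 -> R).
Hypotheses (p1 : 1 < p) (r0 : 0 < r) (eps0 : 0 < eps) (t1_gt0 : 0 < t1) (t1T : (t1%:E < T)%E).
Hypothesis cu1 : Ck_rV 1 u1.
Hypotheses (su0 : supp u0 `<=` [set x | enorm x <= r]) (su1 : supp u1 `<=` [set x | enorm x <= r]).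
Hypothesis J0 : 0 < integral_rV u1.
Hypotheses (ca : Ck_half 1 a) (cb : Ck_half 0 b).
Hypothesis a0 : forall t, 0 <= t -> 0 < a t.
Hypothesis sol : classical_solution a b p u0 u1 eps T u.

(** [t1] is any time before [T]; the clamped functions below instantiate the variables of the
    section on finite speed. *)
Let cl := clamp t1.
Let A t := primitive0 a (cl t).
Let ut t x := dt u (cl t) x.
Let utt t x := dt (dt u) (cl t) x.
Let ui (i : 'I_n.+1) t x := dx i u (cl t) x.
Let uti (i : 'I_n.+1) t x := dx i (dt u) (cl t) x.
Let uii (i : 'I_n.+1) t x := dx i (dx i u) (cl t) x.

Let cl_in t : 0 < t < t1 -> cl t = t.
Proof. by move=> /andP[? ?]; apply: clampE; rewrite !ltW. Qed.

Let in_strip t x : 0 <= t <= t1 -> strip T (t, x : 'rV[R]_n.+1).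
Proof. by move=> /andP[t0 tt1]; split => //=; rewrite (le_lt_trans _ t1T)// lee_fin. Qed.

Let reg : Ck_strip T 2 u. Proof. by have [] := sol. Qed.

Let enorm_coord (x : 'rV[R]_n.+1) k : `|x 0 k| <= enorm x.
Proof.
rewrite -sqrtr_sqr /enorm ler_sqrt; last by apply: sumr_ge0 => i _; exact: sqr_ge0.
by rewrite (bigD1 k)//= lerDl sumr_ge0// => i _; exact: sqr_ge0.
Qed.

(** Vanishing near x, and not only at x, is what makes the partial derivatives of u0 vanish too. *)
Let off_supp (f : 'rV[R]_n.+1 -> R) (x : 'rV[R]_n.+1) k :
  supp f `<=` [set x | enorm x <= r] -> r < `|x 0 k| -> \near x, f x = 0.
Proof.
move=> sf rx; have : ~ supp f x.
  by move=> /sf/=; apply/negP; rewrite -ltNge (lt_le_trans rx)// enorm_coord.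
move=> nsx; have := open_nbhs_nbhs (conj (closed_openC (@closed_closure _ [set x | f x != 0])) nsx).
apply: filterS => y ny; apply/eqP; apply: contrapT => /negP fy.
by apply: ny; apply: subset_closure.
Qed.

Let init (k : 'I_n.+1) (x : 'rV[R]_n.+1) : r < `|x 0 k| ->
  ut 0 x = 0 /\ forall i, ui i 0 x = 0.
Proof.
have [_ _ hu0 hu1] := sol.
have cl0 : cl 0 = 0 by apply: clampE; rewrite lexx ltW.
move=> rx; rewrite /ut /ui cl0; split.
  by rewrite hu1 (nbhs_singleton (off_supp su1 rx)) mulr0.
move=> i; transitivity ('D_(delta_mx 0 i) (cst (0 : R)) x); last exact: derive_cst.
apply: near_eq_derive; apply: filterS (off_supp su0 rx) => y y0.
by rewrite hu0 y0 mulr0.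
Qed.

Let joint (h : R -> 'rV[R]_n.+1 -> R) : {within strip T, continuous (fun z => h z.1 z.2)} ->
  continuous (fun z : R * 'rV[R]_n.+1 => h (cl z.1) z.2).
Proof. by move=> ch; apply: (continuous_clamp_strip t1_gt0 t1T ch). Qed.

Let cut : continuous (fun z : R * 'rV[R]_n.+1 => ut z.1 z.2).
Proof. by apply: joint; have [_ [_ [c _] _]] := reg. Qed.

Let cutt : continuous (fun z : R * 'rV[R]_n.+1 => utt z.1 z.2).
Proof. by apply: joint; have [_ [_ [_ [_ [c _] _]] _]] := reg. Qed.

Let cui i : continuous (fun z : R * 'rV[R]_n.+1 => ui i z.1 z.2).
Proof. by apply: joint; have [_ [_ _ /(_ i)[_ [c _]]]] := reg. Qed.

Let cuti i : continuous (fun z : R * 'rV[R]_n.+1 => uti i z.1 z.2).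
Proof. by apply: joint; have [_ [_ [_ [_ _ /(_ i)[_ [c _]]]] _]] := reg. Qed.

Let cuit i : continuous (fun z : R * 'rV[R]_n.+1 => dt (dx i u) (cl z.1) z.2).
Proof. by apply: joint; have [_ [_ _ /(_ i)[_ [_ [_ [c _] _]]]]] := reg. Qed.

Let cuii i : continuous (fun z : R * 'rV[R]_n.+1 => uii i z.1 z.2).
Proof. by apply: joint; have [_ [_ _ /(_ i)[_ [_ [_ _ /(_ i)[_ [c _]]]]]]] := reg. Qed.

Let half_in t : 0 < t < t1 -> 0 <= t <= t1.
Proof. by move=> /andP[? ?]; rewrite !ltW. Qed.

Let dtime (h : R -> 'rV[R]_n.+1 -> R) (t : R) x : 0 < t < t1 ->
  derivable_half (h ^~ x) t -> is_derive t 1 (h ^~ x) (dt h t x).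
Proof. by move=> /andP[t0 _]; exact: derivable_half_is_derive. Qed.

Let dspace (h : R -> 'rV[R]_n.+1 -> R) i t x : derivable (h t) x (delta_mx 0 i) ->
  is_derive x (delta_mx 0 i) (h t) (dx i h t x).
Proof. exact: derivableP. Qed.

Let du (t : R) x : 0 < t < t1 -> is_derive t 1 (u ^~ x) (dt u t x).
Proof.
move=> ht; apply: dtime => //; have [_ [d _ _]] := reg.
by apply: d; apply: in_strip (half_in ht).
Qed.

Let dut' (t : R) x : 0 < t < t1 -> is_derive t 1 (dt u ^~ x) (dt (dt u) t x).
Proof.
move=> ht; apply: dtime => //; have [_ [_ [_ [d _ _]] _]] := reg.
by apply: d; apply: in_strip (half_in ht).
Qed.

Let dui' i (t : R) x : 0 < t < t1 -> is_derive t 1 (dx i u ^~ x) (dt (dx i u) t x).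
Proof.
move=> ht; apply: dtime => //; have [_ [_ _ /(_ i)[_ [_ [d _ _]]]]] := reg.
by apply: d; apply: in_strip (half_in ht).
Qed.

Let su i t x : 0 <= t <= t1 -> is_derive x (delta_mx 0 i) (u t) (dx i u t x).
Proof.
by move=> ht; apply: dspace; have [_ [_ _ /(_ i)[d _]]] := reg; apply: d; apply: in_strip.
Qed.

Let sut' i t x : 0 <= t <= t1 -> is_derive x (delta_mx 0 i) (dt u t) (dx i (dt u) t x).
Proof.
by move=> ht; apply: dspace; have [_ [_ [_ [_ _ /(_ i)[d _]]] _]] := reg; apply: d; apply: in_strip.
Qed.

Let sui' i t x : 0 <= t <= t1 -> is_derive x (delta_mx 0 i) (dx i u t) (dx i (dx i u) t x).
Proof.
move=> ht; apply: dspace; have [_ [_ _ /(_ i)[_ [_ [_ _ /(_ i)[d _]]]]]] := reg.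
by apply: d; apply: in_strip.
Qed.

(** This is what allows one function [uti] to serve in both [dui] and [sut]. *)
Let mixed i t x : 0 < t < t1 -> dx i (dt u) t x = dt (dx i u) t x.
Proof.
move=> ht; exact: (@Schwarz_rV R n.+1 i u (dt u) (dx i u) (dx i (dt u)) (dt (dx i u)) cl t1 t x
  ht cl_in du (fun s y hs => su i y (half_in hs)) (fun s y hs => sut' i y (half_in hs))
  (dui' i) (@cuti i) (@cuit i)).
Qed.

Let dut (t : R) x : 0 < t < t1 -> is_derive t 1 (ut ^~ x) (utt t x).
Proof.
move=> ht; rewrite /utt (cl_in ht).
exact: (@is_derive_clamp R t1 (dt u ^~ x) t _ ht (dut' x ht)).
Qed.

Let dui i (t : R) x : 0 < t < t1 -> is_derive t 1 (ui i ^~ x) (uti i t x).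
Proof.
move=> ht; rewrite /uti (cl_in ht) (mixed i x ht).
exact: (@is_derive_clamp R t1 (dx i u ^~ x) t _ ht (dui' i x ht)).
Qed.

Let sut i (t : R) x : 0 < t < t1 -> is_derive x (delta_mx 0 i) (ut t) (uti i t x).
Proof. by move=> ht; rewrite /ut /uti (cl_in ht); exact: (sut' i x (half_in ht)). Qed.

Let sui i (t : R) x : 0 < t < t1 -> is_derive x (delta_mx 0 i) (ui i t) (uii i t x).
Proof. by move=> ht; rewrite /ui /uii (cl_in ht); exact: (sui' i x (half_in ht)). Qed.

Let wave t x : 0 < t < t1 ->
  utt t x = a (cl t) ^+ 2 * (\sum_i uii i t x) + b (cl t) * ut t x + `|ut t x| `^ p.
Proof.
move=> ht; have [_ pde _ _] := sol; rewrite /utt /ut /uii (cl_in ht).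
have [t0 tt1] := andP ht; have := pde t x t0; rewrite (lt_trans _ t1T) ?lte_fin// => /(_ isT).
by rewrite -addrA => <-; rewrite /laplacian addrC subrK.
Qed.

Let A_homo s t : s <= t -> A s <= A t.
Proof.
move=> st; apply: primitive0_homo; first by have [] := ca.
- by move=> y y0; exact/ltW/a0.
- by have /andP[] := clamp_itv t1_gt0 s.
- exact: clamp_homo.
Qed.

Let ca0 : {within `[0, +oo[, continuous a}. Proof. by have [] := ca. Qed.

Let A_le t : 0 <= A t <= A t1.
Proof.
have c1 : cl t1 = t1 by apply: clampE; rewrite lexx ltW.
have /andP[ct0 ct1] := clamp_itv t1_gt0 t.
have a0' s : 0 <= s -> 0 <= a s by move=> /a0/ltW.
rewrite /A c1 (primitive0_homo ca0 a0' ct0 ct1) andbT -(primitive0_at0 a).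
exact: (primitive0_homo ca0 a0' (lexx 0) ct0).
Qed.

Let A_at0 : A 0 = 0.
Proof. by rewrite /A /cl clampE ?primitive0_at0// lexx ltW. Qed.

Let dA (t : R) : 0 < t < t1 -> is_derive t 1 A (a (cl t)).
Proof.
move=> ht; rewrite (cl_in ht); have /andP[t0 _] := ht.
exact: (@is_derive_clamp R t1 (primitive0 a) t _ ht (is_derive_primitive0 ca0 t0)).
Qed.

Let da (t : R) : 0 < t < t1 -> is_derive t 1 (fun t => a (cl t)) (derive_half a (cl t)).
Proof.
move=> ht; rewrite (cl_in ht); have /andP[t0 _] := ht.
have [_ [d _]] := ca.
exact: (@is_derive_clamp R t1 a t _ ht (derivable_half_is_derive t0 (d t (ltW t0)))).
Qed.

Let cacl : continuous (fun t => a (cl t)).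
Proof. exact: continuous_clamp_half. Qed.

Let cda : continuous (fun t => derive_half a (cl t)).
Proof. by apply: (continuous_clamp_half t1_gt0 (g := derive_half a)); have [_ [_ []]] := ca. Qed.

Let cbcl : continuous (fun t => b (cl t)).
Proof. by apply: (continuous_clamp_half t1_gt0 (g := b)); have [] := cb. Qed.

Let cA : continuous A.
Proof. exact: continuous_clamp_primitive0. Qed.

Let acl_gt0 t : 0 < a (cl t).
Proof. by apply: a0; have /andP[] := clamp_itv t1_gt0 t. Qed.

Let ut_clamp t x : ut t x = ut (clamp t1 t) x.
Proof. by rewrite /ut {2}/cl clampE// clamp_itv. Qed.

Let G t := integral_rV (ut t).
Let F t := integral_rV (fun x => `|ut t x| `^ p).

Let cG : continuous G.
Proof.
exact: (@continuous_mean R n.+1 p t1 r (fun t => a (cl t)) (fun t => derive_half a (cl t))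
  (fun t => b (cl t)) A ut utt ui uti uii p1 t1_gt0 cut cutt cui cuti cuii cacl cda cbcl cA
  acl_gt0 A_at0 A_homo A_le dA da dut dui sut sui wave init ut_clamp).
Qed.

Let dG (t : R) : 0 < t < t1 -> is_derive t 1 G (b (cl t) * G t + F t).
Proof.
exact: (@is_derive_mean R n.+1 p t1 r (fun t => a (cl t)) (fun t => derive_half a (cl t))
  (fun t => b (cl t)) A ut utt ui uti uii p1 t1_gt0 cut cutt cui cuti cuii cacl cda cbcl cA
  acl_gt0 A_at0 A_homo A_le dA da dut dui sut sui wave init ut_clamp t).
Qed.

Let F_lower t : 0 <= t <= t1 -> 0 < G t ->
  (((A t + r) *+ 2) ^+ n.+1) `^ (1 - p) * G t `^ p <= F t.
Proof.
exact: (@mean_powR_le R n.+1 p t1 r (fun t => a (cl t)) (fun t => derive_half a (cl t))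
  (fun t => b (cl t)) A ut utt ui uti uii p1 cut cutt cui cuti cuii cacl cda cbcl cA
  acl_gt0 A_at0 A_homo A_le dA da dut dui sut sui wave init r0 t).
Qed.

Let G_at0 : G 0 = eps * integral_rV u1.
Proof.
have [_ _ _ hu1] := sol; have cl0 : cl 0 = 0 by apply: clampE; rewrite lexx ltW.
rewrite /G (_ : ut 0 = fun x => eps * u1 x); last by apply/funext => x; rewrite /ut cl0 hu1.
apply: (@integral_rVZ _ _ _ r); first by have [] := cu1.
move=> x /existsNP[k /negP]; rewrite -ltNge => rx.
exact: nbhs_singleton (off_supp su1 rx).
Qed.

Variables (alpha beta : R) (W dW : R -> R).
Hypothesis alpha_ge : forall t, 0 <= t -> n.+1%:R * a t / (primitive0 a t + r) <= alpha.
Hypothesis beta_le : forall t, 0 <= t -> beta <= b t.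
Hypothesis cW : {within `[0, t1], continuous W}.
Hypothesis dW' : forall t : R, 0 < t < t1 -> is_derive t 1 W (dW t).
Hypothesis W0 : W 0 = 0.
Hypothesis dW_le : forall t, 0 < t < t1 -> dW t <= expR ((beta - alpha) * (p - 1) * t).

Lemma solution_time_bound :
  (p - 1) * ((r *+ 2) ^+ n.+1) `^ (1 - p) * W t1 <= (eps * integral_rV u1) `^ (1 - p).
Proof.
have cb0 : {within `[0, +oo[, continuous b} by have [] := cb.
rewrite -G_at0.
apply: (@blow_up_bound R p t1 alpha beta _ (fun t => b (cl t)) G F W dW (primitive0 b)) => //.
- by rewrite powR_gt0// exprn_gt0// pmulrn_lgt0.
- exact: primitive0_continuous.
- by move=> t ht; rewrite (cl_in ht); have /andP[t0 _] := ht; exact: is_derive_primitive0.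
- by move=> t ht; rewrite (cl_in ht) beta_le//; have /andP[/ltW] := ht.
- by move=> t _; apply: integral_rV_ge0 => x; exact: powR_ge0.
- move=> t ht Gt; apply: le_trans (F_lower (half_in ht) Gt).
  rewrite ler_pM2r ?powR_gt0//.
  have /andP[/ltW t0 _] := ht.
  have At : A t = primitive0 a t by rewrite /A (cl_in ht).
  have := pow_radius_le r0 ca0 a0 alpha_ge t0; rewrite -At => hA.
  have /andP[At0 _] := A_le t.
  set X := ((A t + r) *+ 2) ^+ n.+1; set Y := (r *+ 2) ^+ n.+1.
  have X0 : 0 < X by rewrite exprn_gt0// pmulrn_lgt0// ltr_wpDl.
  have Y0 : 0 < Y by rewrite exprn_gt0// pmulrn_lgt0.
  have XY : X <= Y * expR (alpha * t).
    have -> : X = 2 ^+ n.+1 * (A t + r) ^+ n.+1 by rewrite /X -[(A t + r) *+ 2]mulr_natl exprMn.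
    have -> : Y * expR (alpha * t) = 2 ^+ n.+1 * (r ^+ n.+1 * expR (alpha * t)).
      by rewrite /Y -[r *+ 2]mulr_natl exprMn mulrA.
    by rewrite ler_pM2l// exprn_gt0.
  have -> : expR (- (alpha * (p - 1) * t)) = expR (alpha * t) `^ (1 - p).
    by rewrite -expRM; congr expR; ring.
  rewrite -powRM ?expR_ge0 ?(ltW Y0)//.
  have -> : 1 - p = - (p - 1) by ring.
  (* 1 - p is negative, so the upper bound X <= Y e^(alpha t) on the volume becomes the wanted lower
     bound on X^(1-p). *)
  rewrite !powRN lef_pV2 ?posrE ?powR_gt0 ?mulr_gt0 ?expR_gt0//.
  by rewrite ge0_ler_powR ?nnegrE ?subr_ge0 ?(ltW p1) ?(ltW X0) ?mulr_ge0 ?expR_ge0 ?(ltW Y0).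
- by rewrite G_at0 mulr_gt0.
Qed.

End solution.

(** * Lifespan bounds in the two regimes *)

Lemma lee_of_lower_reals {R : realType} (T : \bar R) (X : R) : (0 < T)%E ->
  (forall t : R, 0 < t -> (t%:E < T)%E -> t <= X) -> (T <= X%:E)%E.
Proof.
move=> T0 h; rewrite leNgt; apply/negP.
(* A test time strictly between max(0, X) and T gives the contradiction, also for T = +oo; the
   maximum with 0 keeps it positive. *)
have m0 : 0 <= Num.max 0 X by rewrite le_max lexx.
have mX : X <= Num.max 0 X by rewrite le_max lexx orbT.
case: T T0 h => [s|_|//]; last first.
  move=> h _; have := h (Num.max 0 X + 1); rewrite ltry => /(_ _ isT) h1.
  have /h1 : 0 < Num.max 0 X + 1 by lra.
  by lra.
rewrite !lte_fin => s0 h Xs; have ms : Num.max 0 X < s by rewrite gt_max s0.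
have := h ((Num.max 0 X + s) / 2); rewrite lte_fin => h1.
have : 0 < (Num.max 0 X + s) / 2 by lra.
move=> /h1 h2; have : (Num.max 0 X + s) / 2 < s by lra.
by move=> /h2; lra.
Qed.

Theorem theorem3p1 (R : realType) (n : nat) (p r : R)
    (u0 u1 : 'rV[R]_n -> R) (a b : R -> R) :
  (1 <= n)%N -> 1 < p -> 0 < r ->
  Ck_rV 2 u0 -> Ck_rV 1 u1 ->
  supp u0 `<=` [set x | enorm x <= r] ->
  supp u1 `<=` [set x | enorm x <= r] ->
  0 < integral_rV u1 ->
  Ck_half 1 a -> Ck_half 0 b ->
  (forall t, 0 <= t -> 0 < a t) -> (forall t, 0 <= t -> 0 < b t) ->
  let A := primitive0 a in
  let alpha := ereal_sup [set (n%:R * a t / (A t + r))%:E | t in `[0, +oo[] in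
  let beta := ereal_inf [set (b t)%:E | t in `[0, +oo[] in
  (alpha <= beta)%E ->
  (forall (eps : R) (T : \bar R) (u : R -> 'rV[R]_n -> R),
     0 < eps -> (0 < T)%E -> classical_solution a b p u0 u1 eps T u ->
     (T < +oo)%E) /\
  (exists2 eps0 : R, 0 < eps0 &
   exists2 C : R, 0 < C &
   forall eps : R, 0 < eps <= eps0 ->
     (beta = alpha ->
        (lifespan a b p u0 u1 eps <=
           (C * eps `^ (- (p - 1)) * ln (1 / eps))%:E)%E) /\
     ((alpha < beta)%E ->
        (lifespan a b p u0 u1 eps <= (C * ln (1 / eps))%:E)%E)).
Proof.
case: n u0 u1 => [//|n] u0 u1 _ p1 r0 cu0 cu1 su0 su1 J0 ca cb a0 b0 A alpha beta hab.
have alpha_ub t : 0 <= t -> ((n.+1%:R * a t / (A t + r))%:E <= alpha)%E.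
  by move=> t0; apply: ereal_sup_ubound; exists t => //=; rewrite in_itv/= t0.
have beta_lb t : 0 <= t -> (beta <= (b t)%:E)%E.
  by move=> t0; apply: ereal_inf_lbound; exists t => //=; rewrite in_itv/= t0.
(* The values at t = 0 bound alpha from below and beta from above; alpha <= beta supplies the
   rest. *)
have alpha_fin : alpha \is a fin_num.
  rewrite fin_numElt (lt_le_trans (ltNyr _) (alpha_ub 0 (lexx 0)))/=.
  exact: le_lt_trans (le_trans hab (beta_lb 0 (lexx 0))) (ltry _).
have beta_fin : beta \is a fin_num.
  rewrite fin_numElt (lt_le_trans _ hab)/=; last first.
    by have := alpha_fin; rewrite fin_numElt => /andP[].
  exact: le_lt_trans (beta_lb 0 (lexx 0)) (ltry _).
pose al := fine alpha; pose be := fine beta.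
have alE : alpha = al%:E by rewrite /al fineK.
have beE : beta = be%:E by rewrite /be fineK.
have al_ge t : 0 <= t -> n.+1%:R * a t / (primitive0 a t + r) <= al.
  by move=> /alpha_ub; rewrite alE lee_fin.
have be_le t : 0 <= t -> be <= b t by move=> /beta_lb; rewrite beE lee_fin.
have albe : al <= be by move: hab; rewrite alE beE lee_fin.
have p10 : 0 < p - 1 by rewrite subr_gt0.
set J := integral_rV u1 in J0.
(* [c0] is (p - 1) kappa, and [C1] is chosen so that the time bound reads W(t) <= C1
   eps^(-(p-1)). *)
pose c0 := (p - 1) * ((r *+ 2) ^+ n.+1) `^ (1 - p).
have c00 : 0 < c0 by rewrite mulr_gt0// powR_gt0// exprn_gt0// pmulrn_lgt0.
pose C1 := J `^ (1 - p) / c0.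
have C10 : 0 < C1 by rewrite divr_gt0// powR_gt0.
have data eps : 0 < eps -> (eps * J) `^ (1 - p) = c0 * (C1 * eps `^ (- (p - 1))).
  move=> eps0; rewrite powRM ?(ltW eps0) ?(ltW J0)// /C1.
  have -> : 1 - p = - (p - 1) by ring.
  by field; rewrite gt_eqF.
(* W(t) = t is admissible in both regimes, as 1 is at most the exponential weight. This already
   gives T < +oo. *)
have bound1 eps T u : 0 < eps -> classical_solution a b p u0 u1 eps T u ->
    forall t : R, 0 < t -> (t%:E < T)%E -> t <= C1 * eps `^ (- (p - 1)).
  move=> eps0 sol t t0 tT; rewrite -(ler_pM2l c00) -data//.
  apply: (@solution_time_bound R n p r eps t T u0 u1 a b u p1 r0 eps0 t0 tT cu1 su0 su1
    J0 ca cb a0 sol al be id (fun=> 1) al_ge be_le) => //.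
  - by apply: continuous_subspaceT => x; exact: cvg_id.
  - move=> s /andP[s0 _]; rewrite -[leLHS]expR0 ler_expR mulr_ge0 ?(ltW s0)//.
    by rewrite mulr_ge0 ?subr_ge0// ltW.
split.
  move=> eps T u eps0 T0 sol.
  by apply: le_lt_trans (lee_of_lower_reals T0 (bound1 _ _ _ eps0 sol)) (ltry _).
(* For eps <= 1/e one has ln(1/eps) >= 1, so additive constants can be absorbed into the
   logarithm. *)
exists (expR (-1)); first exact: expR_gt0.
have log_ge1 (eps : R) : 0 < eps <= expR (-1) -> 1 <= ln (1 / eps).
  move=> /andP[eps0 le1]; rewrite div1r lnV ?posrE// lerNr -(expRK (-1)).
  by rewrite ler_ln ?posrE ?expR_gt0.
have lifespan_le eps X : (forall T u, (0 < T)%E -> classical_solution a b p u0 u1 eps T u ->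
    forall t : R, 0 < t -> (t%:E < T)%E -> t <= X) -> (lifespan a b p u0 u1 eps <= X%:E)%E.
  move=> h; apply: ge_ereal_sup => T [T0 [u sol]].
  exact: (lee_of_lower_reals T0 (h T u T0 sol)).
(* [C] is fixed before eps, so the regime is decided first; in each branch the other implication is
   vacuous. *)
have [abE|abN] := eqVneq al be.
  exists C1 => // eps heps; split; last by rewrite alE beE abE ltxx.
  move=> _; apply: lifespan_le => T u T0 sol t t0 tT.
  have /andP[eps0 _] := heps.
  apply: le_trans (bound1 _ _ _ eps0 sol t t0 tT) _.
  by rewrite ler_peMr ?log_ge1// mulr_ge0 ?powR_ge0// ltW.
have ltab : al < be by rewrite lt_neqAle abN.
pose q := (be - al) * (p - 1).
have q0 : 0 < q by rewrite mulr_gt0// subr_gt0.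
have l0 : 0 <= ln (1 + q * C1) by rewrite ln_ge0// lerDl mulr_ge0 ?ltW.
(* From q t <= ln((1 + q C1) eps^(-(p-1))) = ln(1 + q C1) + (p - 1) L and L = ln(1/eps) >= 1. *)
exists ((ln (1 + q * C1) + (p - 1)) / q); first by rewrite divr_gt0// ltr_wpDl.
move=> eps heps; split; first by rewrite alE beE => -[] be_al; rewrite be_al eqxx in abN.
move=> _; apply: lifespan_le => T u T0 sol t t0 tT.
have /andP[eps0 eps1] := heps; have L1 := log_ge1 _ heps.
set L := ln (1 / eps) in L1 *; set E := eps `^ (- (p - 1)).
have E0 : 0 < E by rewrite powR_gt0.
have lnE : ln E = (p - 1) * L by rewrite /E ln_powR /L div1r lnV ?posrE// mulrN mulNr.
have E1 : 1 <= E.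
  rewrite -[leLHS]expR0 -[leRHS]lnK ?posrE// ler_expR lnE mulr_ge0 ?ltW//.
  exact: lt_le_trans L1.
(* Here W is the full integral of the weight e^(q s) over [0, t]. *)
have bound2 : (expR (q * t) - 1) / q <= C1 * E.
  rewrite -(ler_pM2l c00) -data//.
  apply: (@solution_time_bound R n p r eps t T u0 u1 a b u p1 r0 eps0 t0 tT cu1 su0 su1
    J0 ca cb a0 sol al be (fun t => (expR (q * t) - 1) / q) (fun t => expR (q * t))
    al_ge be_le) => //.
  - apply: continuous_subspaceT; apply: continuous_mul; last exact: continuous_const.
    by apply: continuous_sub; [exact: continuous_expRM|exact: continuous_const].
  - move=> s _; have d := is_derive_mul
      (is_derive_sub (is_derive_expRM q s) (is_derive_const 1 s 1))
      (is_derive_const q^-1 s 1).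
    by apply: (is_derive_eq d); field; rewrite gt_eqF.
  - by rewrite mulr0 expR0 subrr mul0r.
(* E >= 1 absorbs the additive 1 left by [bound2]. *)
have : expR (q * t) <= (1 + q * C1) * E.
  by move: bound2; rewrite ler_pdivrMr//; lra.
rewrite -ler_ln ?posrE ?expR_gt0//; last first.
  by rewrite mulr_gt0// ltr_pwDl// mulr_ge0 ?ltW.
rewrite expRK lnM ?posrE//; last by rewrite ltr_pwDl// mulr_ge0 ?ltW.
rewrite lnE => h; rewrite mulrAC ler_pdivlMr// mulrC (le_trans h)//.
by rewrite [leRHS]mulrDl lerD2r -[leLHS]mulr1 ler_wpM2l.
Qed.
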